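(* Let $0\le k\le n-1$ and let $M_0$ be a strictly convex hypersurface embedded in $\mathbb{S}^{n+1}$, contained in the open hemisphere centered at $p$, which is the radial graph (about $p$) of a positive function $\rho_0$ over $\mathbb{S}^n$. Let $M(t)$, $t\in[0,T)$, be a smooth solution, with every $M(t)$ strictly convex, of the flow $$\partial_t X=\Big(c_{n,k}\,\phi'(\rho)-u\,\frac{\sigma_{k+1}(\lambda)}{\sigma_k(\lambda)}\Big)\nu$$ with initial value $M_0$, and write $M(t)$ as the radial graph of $\rho(\cdot,t)$ over $\mathbb{S}^n$, with $u(z,t)$ the value of the support function at the point of $M(t)$ in radial direction $z$. Then for all $(z,t)\in\mathbb{S}^n\times[0,T)$ $$u(z,t)\ \ge\ \min_{z\in\mathbb{S}^n}u(z,0).$$ As a consequence, there is a constant $C$ depending only on the initial data such that $|\rho(\cdot,t)|_{C^1(\mathbb{S}^n)}\le C$ for all $t\in[0,T)$.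
   Context: $n\ge1$; $p\in\mathbb{S}^{n+1}$ is a fixed point lying in the interior of the convex body enclosed by $M_0$. Around $p$ the metric of $\mathbb{S}^{n+1}$ in polar coordinates is $d\rho^2+\phi(\rho)^2dz^2$, with $\phi(\rho)=\sin\rho$, $\rho\in[0,\pi/2)$ the distance to $p$, and $dz^2$ the standard metric on $\mathbb{S}^n$; $\phi'=\cos\rho$. A radial graph of $\rho:\mathbb{S}^n\to(0,\pi/2)$ is the set of points with polar coordinates $(\rho(z),z)$. $\nu$ is the outward unit normal, $u=\langle\phi(\rho)\partial_\rho,\nu\rangle$ is the support function, $\lambda=(\lambda_1,\dots,\lambda_n)$ are the principal curvatures (positive for small geodesic spheres; strictly convex means all $\lambda_i>0$), $\sigma_m$ is the $m$-th elementary symmetric function ($\sigma_0=1$), and $c_{n,k}=\frac{n-k}{k+1}$. ''Depending only on the initial data'' means depending only on $M_0$ (and $n,k$), in particular not on $t$ or $T$. *)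

(* Defs.v *)
From HB Require Import structures.
From mathcomp Require Import all_boot all_order all_algebra.
From mathcomp Require Import all_classical all_reals all_analysis.

Set Implicit Arguments.
Unset Strict Implicit.
Unset Printing Implicit Defensive.

Import Order.TTheory GRing.Theory Num.Theory.
Import numFieldNormedType.Exports.

Local Open Scope classical_set_scope.
Local Open Scope ring_scope.

(** The sphere S^(n+1) is the unit sphere of R^(n+2), and S^n is the unit
    sphere of the tangent space of S^(n+1) at p, i.e. of the orthogonal
    complement of p in R^(n+2).  Functions on S^n are total functions on
    R^(n+2), of which only the values on S^n matter. *)

Section Smooth.
Context {R : realType} {V W : normedModType R}.

(* C^k on an open subset of a finite-dimensional space. *)
Fixpoint Ck (k : nat) (U : set V) (f : V -> W) : Prop :=
  match k with
  | 0%N => forall x, U x -> {for x, continuous f}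
  | k'.+1 => (forall x, U x -> differentiable f x) /\
             forall v : V, Ck k' U (fun x => 'D_v f x)
  end.

(* Smoothness on an arbitrary subset: local extendability to smooth maps.
   On S^n `*` [0, T) this is smoothness up to the initial time. *)
Definition smooth_on (A : set V) (f : V -> W) : Prop :=
  forall a, A a -> exists (U : set V) (g : V -> W),
    [/\ open U, U a, forall k, Ck k U g &
        forall x, A x -> U x -> f x = g x].

End Smooth.

Section Sphere.
Context {R : realType} {n : nat}.
Implicit Types (p x y z v w : 'rV[R]_n.+2) (r s t : R).

Definition dot x y : R := \sum_i x ord0 i * y ord0 i.

Definition ambient_sphere : set 'rV[R]_n.+2 := [set x | dot x x = 1].

Definition dir_sphere p : set 'rV[R]_n.+2 :=
  [set z | dot z z = 1 /\ dot z p = 0].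

Definition dir_tangent p z : set 'rV[R]_n.+2 :=
  [set v | dot v z = 0 /\ dot v p = 0].

(* The retraction of R^(n+2) minus the line spanned by p onto S^n. *)
Definition dir_proj p y : 'rV[R]_n.+2 :=
  let y' := y - dot y p *: p in (Num.sqrt (dot y' y'))^-1 *: y'.

(* The differential df_z(v) of f : S^n -> W, meant for z in S^n and v in the
   tangent space of S^n at z, where dir_proj has differential the identity. *)
Definition sdiff {W : normedModType R} p (f : 'rV[R]_n.+2 -> W) z v : W :=
  'D_v (f \o dir_proj p) z.

(* |f|_{C^1(S^n)} = sup |f| + sup |df|, possibly infinite. *)
Definition C1norm p (f : 'rV[R]_n.+2 -> R) : \bar R :=
  let S0 := [set `|f z| | z in dir_sphere p] in
  let S1 := [set a | exists z v, [/\ dir_sphere p z, dir_tangent p z v,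
                dot v v = 1 & a = `|sdiff p (f : _ -> R^o) z v|]] in
  (ereal_sup (EFin @` S0) + ereal_sup (EFin @` S1))%E.

(* Geodesic polar coordinates about p, and their radial vector field. *)
Definition polar p r z : 'rV[R]_n.+2 := cos r *: p + sin r *: z.

Definition polar_dr p r z : 'rV[R]_n.+2 := - sin r *: p + cos r *: z.

Section RadialGraph.
Variables (p : 'rV[R]_n.+2) (rho : 'rV[R]_n.+2 -> R).

Definition graph_param z : 'rV[R]_n.+2 := polar p (rho z) z.

Definition radial_graph : set 'rV[R]_n.+2 := graph_param @` dir_sphere p.

Definition enclosed_body : set 'rV[R]_n.+2 :=
  [set x | exists r z, [/\ dir_sphere p z, 0 <= r, r <= rho z &
                          x = polar p r z]].

(* nu z is the unit normal, tangent to S^(n+1), at the point of the graph in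
   direction z; outward means that the geodesic of S^(n+1) with initial
   velocity nu z leaves the enclosed body. *)
Definition outward_unit_normal (nu : 'rV[R]_n.+2 -> 'rV[R]_n.+2) : Prop :=
  forall z, dir_sphere p z ->
    [/\ dot (nu z) (nu z) = 1,
        dot (nu z) (graph_param z) = 0,
        forall v, dir_tangent p z v ->
          dot (nu z) (sdiff p graph_param z v) = 0 &
        \forall s \near 0^'+,
          ~ enclosed_body (cos s *: graph_param z + sin s *: nu z)].

(* The principal curvatures with multiplicity: l_i is the eigenvalue of the
   shape operator on the i-th vector of a g-orthonormal principal frame, by
   the Weingarten equation d nu(e_i) = l_i dY(e_i).  As nu is orthogonal to Y,
   the derivative of nu in R^(n+2) is its covariant derivative in S^(n+1).
   With nu outward, the geodesic sphere of radius r has l_i = cot r. *)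
Definition principal_curvatures (nu : 'rV[R]_n.+2 -> 'rV[R]_n.+2) z
    (l : 'I_n -> R) : Prop :=
  exists e : 'I_n -> 'rV[R]_n.+2,
    [/\ forall i, dir_tangent p z (e i),
        forall i j, dot (sdiff p graph_param z (e i))
                        (sdiff p graph_param z (e j)) = (i == j)%:R &
        forall i, sdiff p nu z (e i) = l i *: sdiff p graph_param z (e i)].

Definition strictly_convex_with (nu : 'rV[R]_n.+2 -> 'rV[R]_n.+2)
    (lam : 'rV[R]_n.+2 -> 'I_n -> R) : Prop :=
  outward_unit_normal nu /\
  forall z, dir_sphere p z ->
    principal_curvatures nu z (lam z) /\ forall i, 0 < lam z i.

Definition support_function (nu : 'rV[R]_n.+2 -> 'rV[R]_n.+2) z : R :=
  dot (sin (rho z) *: polar_dr p (rho z) z) (nu z).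

Definition radius_range : Prop :=
  forall z, dir_sphere p z -> 0 < rho z < pi / 2.

Definition strictly_convex_graph : Prop :=
  [/\ smooth_on (dir_sphere p) (rho : _ -> R^o), radius_range &
      exists nu lam, strictly_convex_with nu lam].

End RadialGraph.

Definition sigma (m : nat) (l : 'I_n -> R) : R :=
  \sum_(A : {set 'I_n} | #|A| == m) \prod_(i in A) l i.

Definition cnk (k : nat) : R := (n%:R - k%:R) / k.+1%:R.

(* T may be infinite. *)
Definition times (T : \bar R) : set R := [set t | 0 <= t /\ (t%:E < T)%E].

Definition spacetime p (T : \bar R) : set ('rV[R]_n.+2 * R^o) :=
  [set y | dir_sphere p y.1 /\ times T y.2].

Definition embedding p (F : 'rV[R]_n.+2 -> 'rV[R]_n.+2) : Prop :=
  (forall z z', dir_sphere p z -> dir_sphere p z' -> F z = F z' -> z = z') /\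
  (forall z v, dir_sphere p z -> dir_tangent p z v -> v != 0 ->
     sdiff p F z v != 0).

(* Derivative of a curve on [0, T), one-sided at the initial time. *)
Definition has_time_derivative (T : \bar R) (c : R -> 'rV[R]_n.+2) t w : Prop :=
  ((s - t)^-1 *: (c s - c t) : 'rV[R]_n.+2) @[s --> within (times T) t^'] --> w.

(* X is the family of embeddings of S^n with images M(t), and M(t) is the
   radial graph of rho ^~ t.  The fields nu, lam (and the support function)
   are those of M(t) at its point in radial direction z; the equation for
   X zeta t evaluates them in the radial direction z of X zeta t. *)
Definition flow_solution (k : nat) p (rho0 : 'rV[R]_n.+2 -> R) (T : \bar R)
    (X : 'rV[R]_n.+2 -> R -> 'rV[R]_n.+2)
    (rho : 'rV[R]_n.+2 -> R -> R)
    (nu : 'rV[R]_n.+2 -> R -> 'rV[R]_n.+2)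
    (lam : 'rV[R]_n.+2 -> R -> 'I_n -> R) : Prop :=
  [/\ (smooth_on (spacetime p T)
         (fun y : 'rV[R]_n.+2 * R^o => X y.1 y.2 : 'rV[R]_n.+2) /\
       smooth_on (spacetime p T)
         (fun y : 'rV[R]_n.+2 * R^o => rho y.1 y.2 : R^o)),
      X^~ 0 @` dir_sphere p = radial_graph p rho0,
      forall t, times T t ->
        [/\ embedding p (X^~ t),
            X^~ t @` dir_sphere p = radial_graph p (rho^~ t),
            radius_range p (rho^~ t) &
            strictly_convex_with p (rho^~ t) (nu^~ t) (lam^~ t)] &
      forall zeta z t, dir_sphere p zeta -> dir_sphere p z -> times T t ->
        X zeta t = graph_param p (rho^~ t) z ->
        has_time_derivative T (X zeta) t
          ((cnk k * cos (rho z t)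
            - support_function p (rho^~ t) (nu^~ t) z
              * (sigma k.+1 (lam z t) / sigma k (lam z t))) *: nu z t)].

End Sphere.

(* Main.v *)
(** At a minimum point of the support function u = - <p, nu> on M(t), the
    principal directions e_i satisfy 0 = <p, dnu(e_i)> = lambda_i <p, dY(e_i)>,
    so by strict convexity p is spanned by Y and nu, i.e. u = sin(rho) there.
    Since u <= sin(rho) everywhere, min u = sin(min rho) at every time, and the
    claim reduces to the monotonicity of min rho.  At a minimum of rho the
    hypersurface encloses a tangent geodesic sphere, so lambda_i <= cot(rho)
    and sigma_(k+1) / sigma_k <= c_(n,k) cot(rho): the normal speed is
    nonnegative and the maximum principle applies.  Finally
    |drho(v)| u = sin(rho)^2 |<nu, v>| <= 1 for unit v bounds the gradient. *)

Require Import Defs.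
From mathcomp Require Import all_boot all_order all_algebra.
From mathcomp Require Import all_classical all_reals all_analysis.
From mathcomp Require Import ring lra.

Set Implicit Arguments.
Unset Strict Implicit.
Unset Printing Implicit Defensive.

Import Order.TTheory GRing.Theory Num.Theory.
Import numFieldNormedType.Exports.

Local Open Scope classical_set_scope.
Local Open Scope ring_scope.

(** The definitions put no regularity on [nu]: it is a field of unit normals whose orientation is
    given only by geodesics leaving the body. Three facts have to be recovered from this. Positivity
    of the radial component of [nu] comes from a first-order comparison of the geodesic with the
    graph. Continuity of the support function, which makes its minimum exist, comes from a formula
    for it in terms of rho and the gradient of rho. Differentiability of [nu] in principal
    directions comes from the Weingarten equation having a nonzero right-hand side, a second use of
    strict convexity. The second-order comparison at a minimum of rho then rests on one derivative
    of [nu] and on continuity of the first derivatives of the graph. The flow equation concerns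
    particles X, which need not move radially, so the maximum principle follows a single particle
    through its height <p, X> = cos(rho). *)

(** * One-variable calculus and directional derivatives *)

Section Calculus.
Context {R : realType}.

Lemma is_derive_mx {V : normedModType R} {m n : nat} (M : V -> 'M[R]_(m, n))
    (x v : V) (d : 'M[R]_(m, n)) :
  is_derive x v M d <->
  forall i j, is_derive x v (fun y => M y i j) (d i j).
Proof.
split=> [[dM <-] i j|H].
  apply: DeriveDef; first by move/derivable_mxP: dM; apply.
  by rewrite derive_mx// mxE.
have dM : derivable M x v by apply/derivable_mxP => i j; case: (H i j).
apply: DeriveDef => //; rewrite derive_mx//.
by apply/matrixP => i j; rewrite mxE; case: (H i j).
Qed.

Lemma is_derive_line {V W : normedModType R} (f : V -> W) (z v : V) (d : W) :
  is_derive z v f d <-> is_derive (0 : R) 1 (fun s => f (s *: v + z)) d.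
Proof.
have E : 'D_v f z = 'D_1 (fun s : R => f (s *: v + z)) 0.
  rewrite /derive; set g1 := fun h => _; set g2 := fun h => _.
  suff -> : g1 = g2 by [].
  apply/funext => h; rewrite /g1 /g2 /=.
  by rewrite addr0 scale0r add0r [_%:A]mulr1.
split=> -[h <-]; apply: DeriveDef => //; first exact: (derivable1P f z v).1.
exact: (derivable1P f z v).2.
Qed.

Lemma is_derive_scale {V : normedModType R} {m n : nat} (k : V -> R)
    (f : V -> 'M[R]_(m, n)) (x v : V) (dk : R) (df : 'M[R]_(m, n)) :
  is_derive x v k dk -> is_derive x v f df ->
  is_derive x v (fun y => k y *: f y) (dk *: f x + k x *: df).
Proof.
move=> hk /is_derive_mx hf; apply/is_derive_mx => i j.
have -> : (fun y => (k y *: f y) i j) = k * (fun y => f y i j).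
  by apply/funext => y; rewrite mxE.
apply: (is_derive_eq (is_deriveM hk (hf i j))).
by rewrite !mxE /GRing.scale/=; ring.
Qed.

Lemma is_derive_comp {V W : normedModType R} (f : V -> W) (c : R -> V)
    (s : R) (dc : V) :
  differentiable f (c s) -> is_derive s 1 c dc ->
  is_derive s 1 (f \o c) ('D_dc f (c s)).
Proof.
move=> df [hc hdc].
have dcs : differentiable c s by apply/derivable1_diffP.
have dfc : differentiable (f \o c) s by exact: differentiable_comp.
apply: DeriveDef; first exact: diff_derivable.
by rewrite deriveE// diff_comp//= -(deriveE _ dcs) hdc deriveE.
Qed.

(* The limit defining 'D_v f x takes the junk value point = 0 when it does not
   exist. *)
Lemma derive_nonzero_derivable {V : normedModType R} {m n : nat}
    (f : V -> 'M[R]_(m, n)) (x v : V) :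
  'D_v f x != 0 -> derivable f x v.
Proof.
apply: contraNP => ncvg; apply/eqP; rewrite /derive dvgP//.
by apply/matrixP => i j; rewrite !mxE.
Qed.

Lemma derive_gt0_near_right (f : R -> R) (d : R) :
  is_derive (0 : R) 1 f d -> 0 < d -> \forall s \near 0^'+, f 0 < f s.
Proof.
move=> [hf <-] d0.
have /(_ _ d0) : forall y, y < 'D_1 f 0 ->
    \forall h \near (0 : R)^', y < h^-1 *: ((f \o shift 0) (h *: 1) - f 0).
  exact: cvgr_gt hf.
rewrite !near_withinE => H; near=> s => s0.
have : 0 < s^-1 *: ((f \o shift 0) (s *: 1) - f 0).
  by apply: (near H s) => //; rewrite gt_eqF.
rewrite /= addr0 [_%:A]mulr1 /GRing.scale/= pmulr_rgt0 ?invr_gt0//.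
by rewrite subr_gt0.
Unshelve. all: by end_near. Qed.

Lemma is_derive_min (f : R -> R) (d : R) :
  is_derive (0 : R) 1 f d -> (forall s, f 0 <= f s) -> d = 0.
Proof.
move=> df fmin; have [//|/lt_total dn0] := eqVneq d 0; exfalso.
(* A maximum at 0 excludes strict increase to the right of 0. This is applied to -f when d < 0 and
   to s |-> -f(-s) when d > 0. *)
have no (g : R -> R) : (forall s, g s <= g 0) ->
    ~ \forall s \near 0^'+, g 0 < g s.
  move=> gmax /(@filter_ex _ _ (at_right_proper_filter 0))[s].
  by rewrite ltNge gmax.
case/orP: dn0 => d0.
- apply: (no (fun s => - f s)) => [s|]; first by rewrite lerN2.
  by apply: (@derive_gt0_near_right _ (- d)); lra.
- apply: (no (fun s => - f (- s))) => [s|]; first by rewrite oppr0 lerN2.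
  apply: (@derive_gt0_near_right _ d) => //.
  have dN : is_derive (- (0:R)) 1 f d by rewrite oppr0.
  have h : is_derive (0:R) 1 (f \o -%R) (- d).
    have := @is_derive1_comp R f -%R 0 d (-1) dN.
    by move=> /(_ _); rewrite mulrN1; apply.
  by rewrite -[d]opprK; exact: is_deriveN.
Qed.

Lemma ler_cos_pihalf (x y : R) :
  0 < x < pi / 2 -> 0 < y < pi / 2 -> (cos x <= cos y) = (y <= x).
Proof.
move=> hx hy; have pi0 := pi_gt0 R.
have itv (a : R) : 0 < a < pi / 2 -> a \in `[0, pi].
  by move=> /andP[a0 a1]; rewrite in_itv/=; lra.
by rewrite leNgt ltr_cos ?itv// -leNgt.
Qed.

Lemma cosD_sin_sqr (x : R) : cos x * cos x + sin x * sin x = 1.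
Proof. by rewrite -!expr2 cos2Dsin2. Qed.

Lemma is_derive_cos_sin0 (A B : R) :
  is_derive (0 : R) 1 (fun s => cos s * A + sin s * B) B.
Proof.
have dC (C : R) := @is_derive_cst R R R C 0 1.
have dcos := is_deriveM (@is_derive_cos R 0) (dC A).
have dsin := is_deriveM (@is_derive_sin R 0) (dC B).
apply: (is_derive_eq (is_deriveD dcos dsin)).
by rewrite /GRing.scale/= cos0 sin0 /cst; ring.
Qed.

Lemma derivable_cvg {W : normedModType R} (f : R -> W) (x : R) d :
  is_derive x 1 f d -> f s @[s --> x] --> f x.
Proof.
by case=> df _; exact/differentiable_continuous/derivable1_diffP.
Qed.

(** Concavity of cos on (0, pi/2), through the monotonicity of sin. It turns a gain in radius into a
    proportional loss of height in the maximum principle. *)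
Lemma cos_le_tangent (a b : R) : 0 < a -> a <= b -> b < pi / 2 ->
  cos b <= cos a - sin a * (b - a).
Proof.
move=> a0; rewrite le_eqVlt => /orP[/eqP<- _|ab bpi].
  by rewrite subrr mulr0 subr0.
have [c] := @MVT R cos (fun x => - sin x) a b ab (fun x _ => is_derive_cos x)
  (continuous_subspaceT (@continuous_cos R)).
rewrite in_itv/= => /andP[ac cb] cosE.
have sac : sin a <= sin c.
  by rewrite ltW// ltr_sin// in_itv/=; lra.
by rewrite -lerBlDl cosE mulNr lerN2 ler_wpM2r// subr_ge0 ltW.
Qed.

End Calculus.

(** * The Euclidean inner product and orthonormal bases *)

Section Dot.
Context {R : realType} {n : nat}.
Implicit Types (x y z : 'rV[R]_n.+2) (a : R).

Lemma dotC x y : dot x y = dot y x.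
Proof. by apply: eq_bigr => i _; rewrite mulrC. Qed.

Lemma dotDl x y z : dot (x + y) z = dot x z + dot y z.
Proof. by rewrite -big_split; apply: eq_bigr => i _; rewrite mxE mulrDl. Qed.

Lemma dotZl a x y : dot (a *: x) y = a * dot x y.
Proof. by rewrite mulr_sumr; apply: eq_bigr => i _; rewrite mxE mulrA. Qed.

Lemma dotDr x y z : dot x (y + z) = dot x y + dot x z.
Proof. by rewrite dotC dotDl !(dotC x). Qed.

Lemma dotZr a x y : dot x (a *: y) = a * dot x y.
Proof. by rewrite dotC dotZl (dotC x). Qed.

Lemma dotNl x y : dot (- x) y = - dot x y.
Proof. by rewrite -scaleN1r dotZl mulN1r. Qed.

Lemma dotNr x y : dot x (- y) = - dot x y.
Proof. by rewrite dotC dotNl dotC. Qed.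

Lemma dot0l x : dot 0 x = 0.
Proof. by rewrite -(scale0r 0) dotZl mul0r. Qed.

Definition dotE := (dotDl, dotDr, dotNl, dotNr, dotZl, dotZr).

Lemma dot_ge0 x : 0 <= dot x x.
Proof. by apply: sumr_ge0 => i _; exact: sqr_ge0. Qed.

Lemma dot_eq0 x : (dot x x == 0) = (x == 0).
Proof.
apply/eqP/eqP => [|->]; last exact: dot0l.
move/eqP; rewrite psumr_eq0 => [/allP h|i _]; last exact: sqr_ge0.
apply/rowP => i; rewrite mxE; apply/eqP.
by have := h i (mem_index_enum _); rewrite /= -expr2 sqrf_eq0.
Qed.

(* Expand |y - <x,y> x|^2 >= 0. *)
Lemma dot_unit_le x y : dot x x = 1 -> dot x y ^+ 2 <= dot y y.
Proof.
move=> x1; have := dot_ge0 (y - dot x y *: x).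
by rewrite !dotE x1 (dotC y x); nra.
Qed.

Lemma orthonormal_neq0 (m : nat) (r : 'I_m -> 'rV[R]_n.+2) i :
  (forall i j, dot (r i) (r j) = (i == j)%:R) -> r i != 0.
Proof. by move=> h; rewrite -dot_eq0 h eqxx oner_neq0. Qed.

Lemma is_derive_dot {V : normedModType R} (f g : V -> 'rV[R]_n.+2) (s v : V)
    (df dg : 'rV[R]_n.+2) :
  is_derive s v f df -> is_derive s v g dg ->
  is_derive s v (fun t => dot (f t) (g t)) (dot df (g s) + dot (f s) dg).
Proof.
move=> /is_derive_mx hf /is_derive_mx hg.
have -> : (fun t => dot (f t) (g t)) =
          \sum_i ((fun t => f t ord0 i) * (fun t => g t ord0 i)).
  by apply/funext => t; rewrite fct_sumE.
apply: (is_derive_eq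
  (is_derive_sum (fun i => is_deriveM (hf ord0 i) (hg ord0 i)))).
rewrite -big_split /=; apply: eq_bigr => i _.
by rewrite /GRing.scale/=; ring.
Qed.

(** A square matrix with orthonormal rows also has orthonormal columns ([mulmx1C]), which is the
    completeness of the system r. *)
Lemma orthonormal_expansion (r : 'I_n.+2 -> 'rV[R]_n.+2) x :
  (forall i j, dot (r i) (r j) = (i == j)%:R) ->
  x = \sum_i dot x (r i) *: r i.
Proof.
move=> orth; pose B := \matrix_i r i.
have E (y : 'rV[R]_n.+2) i : (y *m B^T) ord0 i = dot y (r i).
  by rewrite !mxE; apply: eq_bigr => j _; rewrite !mxE.
have BB : B *m B^T = 1%:M.
  apply/matrixP => i j; rewrite !mxE -orth; apply: eq_bigr => k _.
  by rewrite !mxE.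
rewrite -{1}[x]mulmx1 -(mulmx1C BB) mulmxA mulmx_sum_row.
by apply: eq_bigr => i _; rewrite E rowK.
Qed.

End Dot.

(** * C1 maps and curves on the sphere of directions *)

Definition C1_on {R : realType} {V W : normedModType R} (A : set V)
    (f : V -> W) : Prop :=
  forall a, A a -> exists (U : set V) (g : V -> W),
    [/\ open U, U a, Ck 1 U g & forall x, A x -> U x -> f x = g x].

Section DirSphere.
Context {R : realType} {n : nat}.
Variable p : 'rV[R]_n.+2.
Implicit Types (y z v w : 'rV[R]_n.+2) (c : R -> 'rV[R]_n.+2) (s : R).
Local Notation S := (dir_sphere p).

Lemma dir_proj_id z : S z -> dir_proj p z = z.
Proof.
by move=> [z1 zp]; rewrite /dir_proj zp scale0r subr0 z1 sqrtr1 invr1 scale1r.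
Qed.

(** For a unit vector z orthogonal to v this is 1 / |s v + z|. *)
Definition line_scale v s : R := (Num.sqrt (1 + s ^+ 2 * dot v v))^-1.

Lemma line_scale_arg_gt0 v s : 0 < 1 + s ^+ 2 * dot v v.
Proof. by have := dot_ge0 v; have := sqr_ge0 s; nra. Qed.

Lemma line_scale_gt0 v s : 0 < line_scale v s.
Proof. by rewrite invr_gt0 sqrtr_gt0 line_scale_arg_gt0. Qed.

Lemma line_scale_sqr v s : line_scale v s ^+ 2 * (1 + s ^+ 2 * dot v v) = 1.
Proof.
have h := line_scale_arg_gt0 v s.
by rewrite exprVn sqr_sqrtr ?mulVf ?gt_eqF// ltW.
Qed.

Lemma dir_proj_line z v s : S z -> dir_tangent p z v ->
  dir_proj p (s *: v + z) = line_scale v s *: (s *: v + z).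
Proof.
move=> [z1 zp] [vz vp]; rewrite /dir_proj /line_scale.
have -> : dot (s *: v + z) p = 0 by rewrite !dotE zp vp mulr0 addr0.
rewrite scale0r subr0 !dotE z1 (dotC z) vz.
by congr ((Num.sqrt _)^-1 *: _); ring.
Qed.

(** The great circle through z with velocity v at s = 0; for unit v the parameter s is the tangent
    of the angle. It is the natural test curve because [sdiff] is by definition the derivative along
    it at 0. *)
Definition ray z v s : 'rV[R]_n.+2 := dir_proj p (s *: v + z).

Lemma ray0 z v : S z -> ray z v 0 = z.
Proof. by move=> Sz; rewrite /ray scale0r add0r dir_proj_id. Qed.

Lemma ray_sphere z v s : S z -> dir_tangent p z v -> S (ray z v s).
Proof.
move=> Sz Tv; rewrite /ray dir_proj_line//; case: Sz Tv => z1 zp [vz vp].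
split; rewrite !dotE; last by rewrite zp vp; ring.
rewrite z1 (dotC z v) vz -[RHS](line_scale_sqr v s); ring.
Qed.

Definition ray_velocity z v s : 'rV[R]_n.+2 :=
  (- (s * dot v v) * line_scale v s ^+ 3) *: (s *: v + z)
  + line_scale v s *: v.

Lemma is_derive_line_scale v s :
  is_derive s 1 (line_scale v) (- (s * dot v v) * line_scale v s ^+ 3).
Proof.
have h := line_scale_arg_gt0 v s.
have sq0 : Num.sqrt (1 + s ^+ 2 * dot v v) != 0 by rewrite gt_eqF// sqrtr_gt0.
have hd : is_derive s 1 (fun s => 1 + s ^+ 2 * dot v v) (2 * s * dot v v).
  have -> : (fun s => 1 + s ^+ 2 * dot v v) = cst 1 + (dot v v) *: (@id R ^+ 2).
    by apply/funext => x; rewrite /GRing.scale/= /cst !fctE mulrC.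
  apply: (is_derive_eq (is_deriveD (is_derive_cst (1 : R) s 1)
    (is_deriveZ (dot v v) (is_deriveX 2 (is_derive_id s 1))))).
  by rewrite /GRing.scale/= expr1; ring.
pose g := Num.sqrt \o (fun s : R => 1 + s ^+ 2 * dot v v).
have hs : is_derive s 1 g _ := @is_derive1_comp R Num.sqrt _ s _ _ (is_derive1_sqrt h) hd.
rewrite [X in is_derive _ _ X](_ : _ = fun t => (g t)^-1)//.
apply: (is_derive_eq (@is_deriveV R g s _ 1 sq0 hs)).
rewrite /g /line_scale /GRing.scale/= exprVn.
by field.
Qed.

Lemma is_derive_ray z v s : S z -> dir_tangent p z v ->
  is_derive s 1 (ray z v) (ray_velocity z v s).
Proof.
move=> Sz Tv.
have -> : ray z v = fun s => line_scale v s *: (s *: v + z).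
  by apply/funext => x; rewrite /ray dir_proj_line.
apply: is_derive_scale; first exact: is_derive_line_scale.
have -> : (fun x : R => x *: v + z) = (fun x : R => x *: v) + cst z by [].
apply: (is_derive_eq (is_deriveD (is_derive_scale (is_derive_id s 1)
  (is_derive_cst v s 1)) (is_derive_cst z s 1))).
by rewrite scaler0 !addr0 scale1r.
Qed.

Lemma ray_velocity0 z v : ray_velocity z v 0 = v.
Proof.
by rewrite /ray_velocity /line_scale mul0r oppr0 mul0r scale0r add0r
  expr0n/= mul0r addr0 sqrtr1 invr1 scale1r.
Qed.

Lemma curve_velocity_tangent c s w : (forall s, S (c s)) ->
  is_derive s 1 c w -> dir_tangent p (c s) w.
Proof.
move=> Sc hc; split.
- have h := is_derive_dot hc hc.
  have E : (fun t => dot (c t) (c t)) = cst 1 by apply/funext => t; case: (Sc t).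
  move: h; rewrite E (dotC _ w) => -[_]; rewrite derive_cst.
  by move/eqP; rewrite -mulr2n eq_sym mulrn_eq0/= => /eqP.
- have h := is_derive_dot hc (is_derive_cst p s 1).
  have E : (fun t => dot (c t) (cst p t)) = cst 0.
    by apply/funext => t; case: (Sc t).
  by move: h; rewrite E /cst (dotC (c s)) dot0l addr0 => -[_]; rewrite derive_cst.
Qed.

Lemma is_derive_extension {W : normedModType R} (f g : 'rV[R]_n.+2 -> W) U c s w :
  open U -> U (c s) -> differentiable g (c s) ->
  (forall x, S x -> U x -> f x = g x) -> (forall s, S (c s)) ->
  is_derive s 1 c w -> is_derive s 1 (f \o c) ('D_w g (c s)).
Proof.
move=> oU Ucs dg fg Sc hc.
have := is_derive_comp dg hc; apply: near_eq_is_derive.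
have cc : {for s, continuous c}.
  by apply/differentiable_continuous/derivable1_diffP; case: hc.
have : \forall t \near s, U (c t) by apply: cc; exact: open_nbhs_nbhs.
by apply: filterS => t Ut; rewrite /= fg.
Qed.

(** Independence of the extension: the ray stays in S, where f and g agree near z, so the derivative
    defined through [dir_proj] can be computed with any differentiable local extension. *)
Lemma sdiff_extension {W : normedModType R} (f g : 'rV[R]_n.+2 -> W) U z v :
  open U -> U z -> differentiable g z ->
  (forall x, S x -> U x -> f x = g x) -> S z -> dir_tangent p z v ->
  sdiff p f z v = 'D_v g z.
Proof.
move=> oU Uz dg fg Sz Tv.
have h : is_derive (0 : R) 1 (f \o ray z v) ('D_(ray_velocity z v 0) g (ray z v 0)).
  apply: (is_derive_extension oU _ _ fg); rewrite ?ray0//.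
  - by move=> s; exact: ray_sphere.
  - exact: is_derive_ray.
rewrite ray_velocity0 ray0// in h.
by have [] := (is_derive_line (f \o dir_proj p) z v ('D_v g z)).2 h.
Qed.

Lemma is_derive_sdiff {W : normedModType R} (f : 'rV[R]_n.+2 -> W) c s w :
  C1_on S f -> (forall s, S (c s)) -> is_derive s 1 c w ->
  is_derive s 1 (f \o c) (sdiff p f (c s) w).
Proof.
move=> Cf Sc hc; have [U [g [oU Ucs [dg _] fg]]] := Cf _ (Sc s).
rewrite (sdiff_extension oU Ucs (dg _ Ucs) fg (Sc s)).
  exact: (is_derive_extension oU Ucs (dg _ Ucs) fg).
exact: curve_velocity_tangent hc.
Qed.

Lemma ray_velocity_cvg z v :
  ray_velocity z v s @[s --> (0 : R)] --> ray_velocity z v 0.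
Proof.
have dk := is_derive_line_scale v 0.
have kc := derivable_cvg dk.
have idc : s @[s --> (0 : R)] --> (0 : R) by [].
have qc : cst (dot v v) s @[s --> (0 : R)] --> dot v v by exact: cvg_cst.
have Ac : - (s * dot v v) * line_scale v s ^+ 3 @[s --> (0 : R)] -->
    - (0 * dot v v) * line_scale v 0 ^+ 3.
  exact: (cvgM (cvgN (cvgM idc qc)) (cvgM kc (cvgM kc kc))).
have vc : cst v s @[s --> (0 : R)] --> v by exact: cvg_cst.
have zc : cst z s @[s --> (0 : R)] --> z by exact: cvg_cst.
exact: (cvgD (cvgZ Ac (cvgD (cvgZ idc vc) zc)) (cvgZ kc vc)).
Qed.

Lemma sdiff_line {W : normedModType R} (f : 'rV[R]_n.+2 -> W) z v d :
  is_derive (0 : R) 1 (f \o ray z v) d -> sdiff p f z v = d.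
Proof. by move=> h; have [] := (is_derive_line (f \o dir_proj p) z v d).2 h. Qed.

End DirSphere.

(** * Geometry of the radial graph in polar coordinates *)

Section Graph.
Context {R : realType} {n : nat}.
Variables (p : 'rV[R]_n.+2) (rho : 'rV[R]_n.+2 -> R).
Implicit Types (y z v w : 'rV[R]_n.+2) (c : R -> 'rV[R]_n.+2) (s : R).
Local Notation S := (dir_sphere p).
Local Notation Y := (graph_param p rho).
Local Notation dr z := (polar_dr p (rho z) z).
Local Notation drho := (sdiff p rho).

Hypotheses (hp : dot p p = 1) (rhoC1 : C1_on S rho) (rho_range : radius_range p rho).

Lemma sin_rho_gt0 z : S z -> 0 < sin (rho z).
Proof.
move=> /rho_range /andP[r0 r1]; apply: sin_gt0_pi; rewrite r0/=.
by have := pi_gt0 R; lra.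
Qed.

(** The rotation by the angle rho takes (p, z) to (Y, dr). This identity and the next invert it, so
    that inner products with p and z reduce to those with Y and dr. *)
Lemma pole_polarE z : p = cos (rho z) *: Y z - sin (rho z) *: dr z.
Proof.
rewrite /graph_param /polar /polar_dr !scalerDr !scalerA opprD addrACA.
rewrite [X in _ + X](_ : _ = 0); last by rewrite mulrC subrr.
by rewrite addr0 -scaleNr -scalerDl mulrN opprK cosD_sin_sqr scale1r.
Qed.

Lemma dir_polarE z : z = sin (rho z) *: Y z + cos (rho z) *: dr z.
Proof.
rewrite /graph_param /polar /polar_dr !scalerDr !scalerA addrACA.
rewrite -!scalerDl mulrN mulrC subrr scale0r add0r addrC.
by rewrite addrC [X in X *: _]addrC cosD_sin_sqr scale1r.
Qed.

Lemma dot_graph z : S z -> dot (Y z) (Y z) = 1.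
Proof.
move=> [z1 zp]; rewrite /graph_param /polar !dotE hp z1 zp dotC zp.
by rewrite -[RHS](cosD_sin_sqr (rho z)); ring.
Qed.

Lemma dot_pole_graph z : S z -> dot p (Y z) = cos (rho z).
Proof.
by move=> [z1 zp]; rewrite /graph_param /polar !dotE hp (dotC p) zp; ring.
Qed.

Lemma dot_dr z : S z -> dot (dr z) (dr z) = 1.
Proof.
move=> [z1 zp]; rewrite /polar_dr !dotE hp z1 zp dotC zp.
by rewrite -[RHS](cosD_sin_sqr (rho z)); ring.
Qed.

Lemma dot_graph_dr z : S z -> dot (Y z) (dr z) = 0.
Proof.
move=> [z1 zp]; rewrite /graph_param /polar /polar_dr !dotE hp z1 zp dotC zp.
by ring.
Qed.

Lemma dot_pole_dr z : S z -> dot p (dr z) = - sin (rho z).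
Proof.
by move=> [z1 zp]; rewrite /polar_dr !dotE hp (dotC p) zp; ring.
Qed.

Lemma dot_tangent_graph z v : dir_tangent p z v -> dot v (Y z) = 0.
Proof.
by move=> [vz vp]; rewrite /graph_param /polar !dotE vz vp; ring.
Qed.

Lemma dot_tangent_dr z v : dir_tangent p z v -> dot v (dr z) = 0.
Proof.
by move=> [vz vp]; rewrite /polar_dr !dotE vz vp; ring.
Qed.

Lemma is_derive_graph c s w : (forall s, S (c s)) -> is_derive s 1 c w ->
  is_derive s 1 (Y \o c) (drho (c s) w *: dr (c s) + sin (rho (c s)) *: w).
Proof.
move=> Sc hc; have hr := is_derive_sdiff rhoC1 Sc hc.
have -> : Y \o c = (fun s => cos (rho (c s)) *: p)
                   + (fun s => sin (rho (c s)) *: c s) by [].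
have hcos := @is_derive1_comp R cos (rho \o c) s _ _ (is_derive_cos _) hr.
have hsin := @is_derive1_comp R sin (rho \o c) s _ _ (is_derive_sin _) hr.
apply: (is_derive_eq (is_deriveD (is_derive_scale hcos (is_derive_cst p s 1))
                                 (is_derive_scale hsin hc))).
rewrite /= scaler0 addr0 addrA; congr (_ + _).
by rewrite /polar_dr scalerDr !scalerA; congr (_ *: _ + _ *: _); ring.
Qed.

Lemma sdiff_graph z v : S z -> dir_tangent p z v ->
  sdiff p Y z v = drho z v *: dr z + sin (rho z) *: v.
Proof.
move=> Sz Tv; apply: sdiff_line.
have h := is_derive_graph (fun s => ray_sphere s Sz Tv) (is_derive_ray 0 Sz Tv).
by rewrite ray0// ray_velocity0 in h.
Qed.

Lemma is_derive_rho_ray z v s : S z -> dir_tangent p z v ->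
  is_derive s 1 (rho \o ray p z v) (drho (ray p z v s) (ray_velocity z v s)).
Proof.
move=> Sz Tv; apply: is_derive_sdiff => // [t|]; first exact: ray_sphere.
exact: is_derive_ray.
Qed.

Lemma is_derive_graph_ray z v s : S z -> dir_tangent p z v ->
  is_derive s 1 (Y \o ray p z v)
    (sdiff p Y (ray p z v s) (ray_velocity z v s)).
Proof.
move=> Sz Tv; have Sr t := ray_sphere t Sz Tv.
have hr := is_derive_ray s Sz Tv.
rewrite sdiff_graph//; first exact: is_derive_graph.
exact: curve_velocity_tangent hr.
Qed.

Lemma dot_graph_sdiff z v : S z -> dir_tangent p z v ->
  dot (Y z) (sdiff p Y z v) = 0.
Proof.
move=> Sz Tv.
rewrite sdiff_graph// dotDr !dotZr dot_graph_dr// (dotC _ v).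
by rewrite (dot_tangent_graph Tv) !mulr0 addr0.
Qed.

Lemma dot_pole_sdiff z v : S z -> dir_tangent p z v ->
  dot p (sdiff p Y z v) = - (sin (rho z) * drho z v).
Proof.
move=> Sz Tv; rewrite sdiff_graph// dotDr !dotZr dot_pole_dr//.
by case: Tv => _; rewrite dotC => ->; ring.
Qed.

End Graph.

(** * The outward normal and its radial component *)

Section Normal.
Context {R : realType} {n : nat}.
Variables (p : 'rV[R]_n.+2) (rho : 'rV[R]_n.+2 -> R).
Variable nu : 'rV[R]_n.+2 -> 'rV[R]_n.+2.
Implicit Types (y z v w : 'rV[R]_n.+2) (c : R -> 'rV[R]_n.+2) (s : R).
Local Notation S := (dir_sphere p).
Local Notation Y := (graph_param p rho).
Local Notation dr z := (polar_dr p (rho z) z).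
Local Notation drho := (sdiff p rho).
Local Notation u := (support_function p rho nu).

Hypotheses (hp : dot p p = 1) (rhoC1 : C1_on S rho) (rho_range : radius_range p rho)
  (nu_normal : outward_unit_normal p rho nu).

(** The cosine of the angle between [nu] and the radial field, written a below; the remaining part
    tau of [nu] is tangent to the sphere of directions. *)
Definition normal_slope z : R := dot (dr z) (nu z).

Definition normal_tangential z : 'rV[R]_n.+2 := nu z - normal_slope z *: dr z.

Lemma normalE z : nu z = normal_slope z *: dr z + normal_tangential z.
Proof. by rewrite addrC subrK. Qed.

Lemma support_functionE z : u z = sin (rho z) * normal_slope z.
Proof. by rewrite /support_function dotZl. Qed.

Lemma dot_pole_normal z : S z -> dot p (nu z) = - u z.
Proof.
move=> Sz; have [_ nuY _ _] := nu_normal Sz.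
rewrite support_functionE /normal_slope [in LHS](pole_polarE p rho z).
by rewrite dotDl dotNl !dotZl (dotC (Y z)) nuY mulr0 add0r.
Qed.

Lemma normal_tangential_tangent z : S z -> dir_tangent p z (normal_tangential z).
Proof.
move=> Sz; have [_ nuY _ _] := nu_normal Sz.
have tY : dot (normal_tangential z) (Y z) = 0.
  rewrite /normal_tangential dotDl dotNl dotZl nuY (dotC _ (Y z)).
  by rewrite (dot_graph_dr _ hp Sz); ring.
have tr : dot (normal_tangential z) (dr z) = 0.
  rewrite /normal_tangential dotDl dotNl dotZl (dot_dr _ hp Sz).
  by rewrite /normal_slope (dotC (nu z)); ring.
split.
- rewrite [X in dot _ X](dir_polarE p rho z) dotDr !dotZr tY tr; ring.
- rewrite [X in dot _ X](pole_polarE p rho z) dotDr dotNr !dotZr tY tr; ring.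
Qed.

Lemma dot_normal_tangent z v : S z -> dir_tangent p z v ->
  dot (nu z) v = dot (normal_tangential z) v.
Proof.
move=> Sz Tv; rewrite [in LHS]normalE dotDl dotZl (dotC _ v).
by rewrite (dot_tangent_dr rho Tv) mulr0 add0r.
Qed.

(** This is <nu, dY(v)> = 0 with dY(v) = drho(v) dr + sin(rho) v. Together with a^2 + |tau|^2 = 1 it
    determines [nu] up to sign. *)
Lemma normal_slope_drho z v : S z -> dir_tangent p z v ->
  normal_slope z * drho z v = - (sin (rho z) * dot (normal_tangential z) v).
Proof.
move=> Sz Tv; have [_ _ nuT _] := nu_normal Sz.
have := nuT v Tv; rewrite (sdiff_graph rhoC1 Sz Tv) dotDr !dotZr.
rewrite (dot_normal_tangent Sz Tv) (dotC (nu z)) -/(normal_slope z).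
by move=> h; lra.
Qed.

Lemma normal_slope_sqr z : S z ->
  normal_slope z ^+ 2 + dot (normal_tangential z) (normal_tangential z) = 1.
Proof.
move=> Sz; have [nu1 _ _ _] := nu_normal Sz.
rewrite -(dot_normal_tangent Sz (normal_tangential_tangent Sz)).
rewrite /normal_tangential dotDr dotNr dotZr nu1 (dotC (nu z)) -/(normal_slope z).
by ring.
Qed.

(** If a = 0, the slope identity tested on v = tau gives sin(rho) |tau|^2 = 0, whereas |tau| = 1. *)
Lemma normal_slope_neq0 z : S z -> normal_slope z != 0.
Proof.
move=> Sz; apply/eqP => a0.
have := normal_slope_sqr Sz.
have := normal_slope_drho Sz (normal_tangential_tangent Sz).
by rewrite a0 => h1 h2; have := sin_rho_gt0 rho_range Sz; nra.
Qed.

(* If the radial component of the normal were negative, the geodesic leaving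
   in the direction nu would lie below the graph to first order, because
   its height changes at rate - (sin rho) a while the boundary changes at
   the rate given by the tangential part of nu. *)
Lemma geodesic_enclosed z s (a := normal_slope z) (tau := normal_tangential z)
    (alpha := cos s * sin (rho z) + sin s * (a * cos (rho z))) :
  S z -> 0 < alpha ->
  cos (rho (ray p z tau (sin s / alpha))) <=
    cos s * cos (rho z) - sin s * (a * sin (rho z)) ->
  enclosed_body p rho (cos s *: Y z + sin s *: nu z).
Proof.
move=> Sz alpha0 hcos; have Tt := normal_tangential_tangent Sz.
have [nu1 nuY _ _] := nu_normal Sz.
set y := _ + _; set h := cos s * cos _ - _ in hcos.
set z' := ray _ _ _ _ in hcos.
have Sz' : S z' by exact: ray_sphere.
set k := line_scale tau (sin s / alpha).
have k0 : 0 < k := line_scale_gt0 _ _.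
(* The geodesic point equals h p + alpha (z + (sin s / alpha) tau). Hence its direction is the ray
   at parameter sin s / alpha, and its polar radius is [acos h]. *)
have yE : y = h *: p + (alpha / k) *: z'.
  rewrite /z' /ray dir_proj_line// -/k scalerA divfK ?gt_eqF//.
  rewrite scalerDr scalerA [alpha * _]mulrC divfK ?gt_eqF//.
  rewrite /y normalE -/a -/tau /graph_param /polar /polar_dr.
  by apply/rowP => i; rewrite !mxE /alpha /h; ring.
clearbody z' k.
have y1 : dot y y = 1.
  rewrite /y dotDl !dotDr !dotZl !dotZr nu1 nuY (dot_graph _ hp Sz) dotC nuY.
  by rewrite -[RHS](cosD_sin_sqr s); ring.
have hk : h ^+ 2 + (alpha / k) ^+ 2 = 1.
  case: Sz' => z1 zp; rewrite -y1 yE dotDl !dotDr !dotZl !dotZr hp z1 zp dotC zp.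
  by ring.
have ak0 : 0 < alpha / k by rewrite divr_gt0.
have h1 : -1 <= h <= 1 by apply/andP; split; nra.
have cosr : cos (acos h) = h by rewrite acosK// in_itv.
have sinr : sin (acos h) = alpha / k.
  rewrite sin_acos// -hk [_ - _](_ : _ = (alpha / k) ^+ 2); last by ring.
  by rewrite sqrtr_sqr gtr0_norm.
exists (acos h), z'; split => //.
- exact: acos_ge0.
- rewrite leNgt -ltr_cos ?cosr -?leNgt// in_itv/=.
    by have /andP[r0 r1] := rho_range Sz'; have := pi_gt0 R; lra.
  by rewrite acos_ge0// acos_lepi.
- by rewrite /polar cosr sinr.
Qed.

Lemma normal_slope_gt0 z : S z -> 0 < normal_slope z.
Proof.
move=> Sz; rewrite lt_neqAle eq_sym normal_slope_neq0//= leNgt; apply/negP => a0.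
have Tt := normal_tangential_tangent Sz.
have adrho := normal_slope_drho Sz Tt; have asq := normal_slope_sqr Sz.
have sr0 := sin_rho_gt0 rho_range Sz; have [_ _ _ leaves] := nu_normal Sz.
pose a := normal_slope z; pose tau := normal_tangential z.
pose alpha (s : R) := cos s * sin (rho z) + sin s * (a * cos (rho z)).
pose q (s : R) := sin s / alpha s.
pose h (s : R) := cos s * cos (rho z) - sin s * (a * sin (rho z)).
have alpha0 : alpha 0 = sin (rho z) by rewrite /alpha cos0 sin0; ring.
have q0 : q 0 = 0 by rewrite /q sin0 mul0r.
have dalpha : is_derive (0 : R) 1 alpha (a * cos (rho z)).
  exact: is_derive_cos_sin0.
have dh : is_derive (0 : R) 1 h (- (a * sin (rho z))).
  have -> : h = fun s => cos s * cos (rho z) + sin s * - (a * sin (rho z)).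
    by apply/funext => s; rewrite /h mulrN.
  exact: is_derive_cos_sin0.
have alpha0_neq0 : alpha 0 != 0 by rewrite alpha0 gt_eqF.
have dq : is_derive (0 : R) 1 q (sin (rho z))^-1.
  have -> : q = sin * (fun s => (alpha s)^-1) by [].
  have dV := is_deriveV alpha0_neq0 dalpha.
  apply: (is_derive_eq (is_deriveM (@is_derive_sin R 0) dV)).
  by rewrite /GRing.scale/= alpha0 sin0 cos0; ring.
have dr : is_derive (0 : R) 1 ((rho \o ray p z tau) \o q)
    (drho z tau * (sin (rho z))^-1).
  apply: is_derive1_comp; rewrite q0.
  have := is_derive_rho_ray rhoC1 0 Sz Tt.
  by rewrite (ray0 _ Sz) ray_velocity0 => Drho; exact: Drho.
have dc : is_derive (0 : R) 1 (cos \o ((rho \o ray p z tau) \o q))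
    (- sin (rho z) * (drho z tau * (sin (rho z))^-1)).
  by apply: is_derive1_comp; rewrite /= q0 (ray0 _ Sz); exact: is_derive_cos.
have df := is_deriveB dh dc.
have := derive_gt0_near_right df.
(* By |tau|^2 = 1 - a^2 the two rates combine to -sin(rho) / a, which is positive if a < 0; the
   geodesic would then enter the body. *)
have -> : - (a * sin (rho z)) - - sin (rho z) * (drho z tau * (sin (rho z))^-1) =
          - (sin (rho z) * a^-1).
  have a_neq0 : a != 0 by exact: normal_slope_neq0.
  have -> : drho z tau = - (sin (rho z) * dot tau tau) / a.
    by rewrite -adrho mulrC mulKf.
  have -> : dot tau tau = 1 - a ^+ 2 by rewrite -asq addrAC subrr add0r.
  by field; rewrite a_neq0 gt_eqF.
rewrite oppr_gt0 pmulr_rlt0// invr_lt0 => /(_ a0) H.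
have alpha_gt0 : \forall s \near 0^'+, 0 < alpha s.
  have calpha : {for 0, continuous alpha}.
    by apply/differentiable_continuous/derivable1_diffP; case: dalpha.
  have : \forall s \near (0 : R), 0 < alpha s.
    by apply: cvgr_gt calpha _ _; rewrite alpha0.
  by rewrite near_withinE; apply: filterS.
have [s [[hs alphas] out]] := @filter_ex _ _ (at_right_proper_filter 0) _
  (filterI (filterI H alpha_gt0) leaves).
apply: out; apply: geodesic_enclosed => //; apply: ltW.
move: hs; rewrite !fctE /= q0 (ray0 _ Sz) {1}/h cos0 sin0.
by rewrite mul1r mul0r subr0 subrr subr_gt0.
Qed.

Lemma support_function_gt0 z : S z -> 0 < u z.
Proof.
move=> Sz; rewrite support_functionE; apply: mulr_gt0.
  exact: (sin_rho_gt0 rho_range Sz).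
exact: normal_slope_gt0.
Qed.

Lemma support_function_le z : S z -> u z <= sin (rho z).
Proof.
move=> Sz; have := normal_slope_sqr Sz; have := dot_ge0 (normal_tangential z).
have := sin_rho_gt0 rho_range Sz; have := normal_slope_gt0 Sz.
rewrite support_functionE => a0 s0 T0 aT.
have a1 : normal_slope z <= 1 by nra.
by rewrite -[leRHS]mulr1; apply: ler_wpM2l => //; exact: ltW.
Qed.

Lemma drho_le z v : S z -> dir_tangent p z v -> dot v v = 1 ->
  `|drho z v| * u z <= 1.
Proof.
move=> Sz Tv v1; have [nu1 _ _ _] := nu_normal Sz.
have drhoE : drho z v * u z = - (sin (rho z) ^+ 2 * dot (normal_tangential z) v).
  by rewrite support_functionE mulrC -mulrA normal_slope_drho//; ring.
have := dot_unit_le (normal_tangential z) v1; rewrite dotC.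
have := normal_slope_sqr Sz; have := sqr_ge0 (normal_slope z).
have := sin2cos2 (rho z); have := sqr_ge0 (cos (rho z)).
have := sqr_ge0 (sin (rho z)).
rewrite -[X in _ * X](gtr0_norm (support_function_gt0 Sz)) -normrM drhoE normrN.
set s2 := sin _ ^+ 2; set X := dot _ v => s0 c0 sc a0 aT XT.
have X1 : -1 <= X <= 1 by apply/andP; split; nra.
by case/andP: X1 => X1 X2; rewrite ler_norml; apply/andP; split; nra.
Qed.

End Normal.

(** * Limits of inner products and gradients of local extensions *)

Section DotLimits.
Context {R : realType} {n : nat}.

Lemma cvg_dot {T : Type} {F : set_system T} {FF : Filter F}
    (f g : T -> 'rV[R]_n.+2) (a b : 'rV[R]_n.+2) :
  (forall i, f t ord0 i @[t --> F] --> a ord0 i) ->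
  (forall i, g t ord0 i @[t --> F] --> b ord0 i) ->
  dot (f t) (g t) @[t --> F] --> dot a b.
Proof.
by move=> fa gb; apply: cvg_big => [|i _]; [exact: add_continuous|apply: cvgM].
Qed.

Lemma cvg_entry {T : Type} {F : set_system T} {FF : Filter F}
    (f : T -> 'rV[R]_n.+2) (a : 'rV[R]_n.+2) i :
  f t @[t --> F] --> a -> f t ord0 i @[t --> F] --> a ord0 i.
Proof. by move=> fa; apply: (continuous_cvg _ (@coord_continuous _ _ _ ord0 i a) fa). Qed.

Definition gradient (g : 'rV[R]_n.+2 -> R) (x : 'rV[R]_n.+2) : 'rV[R]_n.+2 :=
  \row_i 'D_(delta_mx ord0 i) g x.

Lemma derive_gradient (g : 'rV[R]_n.+2 -> R) (x v : 'rV[R]_n.+2) :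
  differentiable g x -> 'D_v g x = dot (gradient g x) v.
Proof.
move=> dg; rewrite deriveE// {1}[v]row_sum_delta linear_sum.
by apply: eq_bigr => i _; rewrite linearZ/= mxE deriveE// mulrC.
Qed.

Lemma gradient_continuous (g : 'rV[R]_n.+2 -> R) U x i :
  Ck 1 U g -> U x -> {for x, continuous (fun y => gradient g y ord0 i)}.
Proof.
move=> [_ Dg] Ux; have := Dg (delta_mx ord0 i) x Ux.
suff -> : (fun y => gradient g y ord0 i) = 'D_(delta_mx ord0 i) g by [].
by apply/funext => y; rewrite mxE.
Qed.

End DotLimits.

(** * Minimum points of the support function and of the radius *)

Section CriticalPoints.
Context {R : realType} {n : nat}.
Variables (p : 'rV[R]_n.+2) (rho : 'rV[R]_n.+2 -> R).
Variable nu : 'rV[R]_n.+2 -> 'rV[R]_n.+2.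
Implicit Types (y z v w : 'rV[R]_n.+2) (s : R) (l : 'I_n -> R).
Local Notation S := (dir_sphere p).
Local Notation Y := (graph_param p rho).
Local Notation dY := (sdiff p Y).
Local Notation u := (support_function p rho nu).

Hypotheses (hp : dot p p = 1) (rhoC1 : C1_on S rho) (rho_range : radius_range p rho)
  (nu_normal : outward_unit_normal p rho nu).

(** Continuity is read off from u = sin(rho)^2 / sqrt(sin(rho)^2 + |grad rho|^2), where positivity
    of a selects the root. On S, [N] is the squared length of the tangential part [H] of the
    gradient [G] of a local extension. *)
Lemma support_function_continuous : {within S, continuous u}.
Proof.
apply/subspace_continuousP => z Sz.
have [U [g [oU Uz [dg Dg] fg]]] := rhoC1 Sz.
pose G := gradient g.
pose N x := dot (G x) (G x) - dot (G x) x ^+ 2 - dot (G x) p ^+ 2.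
pose E x := sin (g x) ^+ 2 / Num.sqrt (sin (g x) ^+ 2 + N x).
have uE x : S x -> U x -> u x = E x /\ 0 < sin (g x) ^+ 2 + N x.
  move=> Sx Ux; pose a := normal_slope p rho nu x.
  pose tau := normal_tangential p rho nu x.
  have a0 : 0 < a := normal_slope_gt0 hp rhoC1 rho_range nu_normal Sx.
  have Tt : dir_tangent p x tau := normal_tangential_tangent hp nu_normal Sx.
  have aT : a ^+ 2 + dot tau tau = 1 := normal_slope_sqr hp nu_normal Sx.
  have s0 := sin_rho_gt0 rho_range Sx.
  have slope v : dir_tangent p x v ->
      a * dot (G x) v = - (sin (rho x) * dot tau v).
    move=> Tv; rewrite -(normal_slope_drho rhoC1 nu_normal Sx Tv).
    rewrite -(derive_gradient _ (dg _ Ux)).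
    by rewrite (sdiff_extension oU Ux (dg _ Ux) fg Sx Tv).
  clearbody tau; pose H := G x - dot (G x) x *: x - dot (G x) p *: p.
  case: (Sx) => x1 xp; case: (Tt) => taux taup.
  have TH : dir_tangent p x H.
    split; rewrite /H !dotDl !dotNl !dotZl; first by rewrite x1 (dotC p) xp; ring.
    by rewrite hp xp; ring.
  have tauH : dot tau H = dot (G x) tau.
    by rewrite /H !dotDr !dotNr !dotZr taux taup (dotC tau); ring.
  have GH : dot (G x) H = N x.
    by rewrite /H !dotDr !dotNr !dotZr /N; ring.
  have e1 := slope _ TH; have e2 := slope _ Tt.
  rewrite GH tauH in e1.
  (* The slope identity tested on H and on tau expresses N through |tau|^2 = 1 - a^2, which
     eliminates tau. *)
  have key : a ^+ 2 * (sin (rho x) ^+ 2 + N x) = sin (rho x) ^+ 2.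
    have T1 : dot tau tau = 1 - a ^+ 2 by rewrite -aT addrAC subrr add0r.
    have -> : N x = - (sin (rho x) * dot (G x) tau) / a.
      by rewrite -e1 mulrC mulKf// gt_eqF.
    have -> : dot (G x) tau = - (sin (rho x) * (1 - a ^+ 2)) / a.
      by rewrite -T1 -e2 mulrC mulKf// gt_eqF.
    by field; rewrite gt_eqF.
  rewrite /E -(fg _ Sx Ux).
  have pos : 0 < sin (rho x) ^+ 2 + N x.
    by rewrite -(@pmulr_rgt0 _ (a ^+ 2)) ?exprn_gt0// key exprn_gt0.
  split => //; have q0 : Num.sqrt (sin (rho x) ^+ 2 + N x) != 0.
    by rewrite gt_eqF// sqrtr_gt0.
  have aq : a * Num.sqrt (sin (rho x) ^+ 2 + N x) = sin (rho x).
    rewrite -[LHS]gtr0_norm ?mulr_gt0 ?sqrtr_gt0// -sqrtr_sqr exprMn.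
    by rewrite sqr_sqrtr ?ltW// key sqrtr_sqr gtr0_norm.
  rewrite support_functionE -/a; apply: (mulIf q0).
  by rewrite divfK// -mulrA aq expr2.
have [uz pos] := uE z Sz Uz.
have gc : g x @[x --> z] --> g z by exact: differentiable_continuous (dg _ Uz).
have Gc i : G x ord0 i @[x --> z] --> G z ord0 i.
  have h := @gradient_continuous R n g U z i (conj dg Dg) Uz.
  exact: h.
have Ec : E x @[x --> z] --> E z.
  have sc : sin (g x) ^+ 2 @[x --> z] --> sin (g z) ^+ 2.
    have s1 : sin (g x) @[x --> z] --> sin (g z).
      exact: (cvg_comp g (@sin R) gc (@continuous_sin R (g z))).
    exact: (cvgM s1 s1).
  have Nc : N x @[x --> z] --> N z.
    have c1 : dot (G t) (G t) @[t --> z] --> dot (G z) (G z).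
      exact: (cvg_dot Gc Gc).
    have c2 : dot (G t) t @[t --> z] --> dot (G z) z.
      by apply: cvg_dot Gc _ => i; exact: coord_continuous.
    have c3 : dot (G t) p @[t --> z] --> dot (G z) p.
      by apply: cvg_dot Gc _ => i; exact: cvg_cst.
    exact: (cvgB (cvgB c1 (cvgM c2 c2)) (cvgM c3 c3)).
  have q0 : Num.sqrt (sin (g z) ^+ 2 + N z) != 0 by rewrite gt_eqF// sqrtr_gt0.
  have qc : Num.sqrt (sin (g x) ^+ 2 + N x) @[x --> z]
      --> Num.sqrt (sin (g z) ^+ 2 + N z).
    exact: (cvg_comp _ (@Num.sqrt R) (cvgD sc Nc) (@sqrt_continuous R _)).
  exact: (cvgM sc (cvgV q0 qc)).
suff : u x @[x --> within S (nbhs z)] --> E z by rewrite -uz.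
have Ew : E x @[x --> within S (nbhs z)] --> E z by exact: cvg_within_filter Ec.
apply: (cvg_trans _ Ew); apply: near_eq_cvg; rewrite near_withinE.
have : \forall x \near z, U x by exact: open_nbhs_nbhs.
apply: filterS => x Ux Sx; have [-> _] := uE x Sx Ux; reflexivity.
Qed.

(* Y, nu and the principal directions form an orthonormal basis of R^(n+2). *)
Lemma frame_expansion z (e : 'I_n -> 'rV[R]_n.+2) x : S z ->
  (forall i, dir_tangent p z (e i)) ->
  (forall i j, dot (dY z (e i)) (dY z (e j)) = (i == j)%:R) ->
  x = dot x (Y z) *: Y z + dot x (nu z) *: nu z
      + \sum_i dot x (dY z (e i)) *: dY z (e i).
Proof.
move=> Sz Te orth; have [nu1 nuY nuT _] := nu_normal Sz.
have YT i := dot_graph_sdiff hp rhoC1 Sz (Te i).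
have Y1 := dot_graph rho hp Sz.
pose r (i : 'I_n.+2) := if unlift ord0 i is Some j then
  (if unlift ord0 j is Some k then dY z (e k) else nu z) else Y z.
have r_orth i j : dot (r i) (r j) = (i == j)%:R.
  rewrite /r; case: (unliftP ord0 i) => [i' ->|->];
    case: (unliftP ord0 j) => [j' ->|->]; rewrite ?(inj_eq lift_inj)//.
  - case: (unliftP ord0 i') => [i'' ->|->];
      case: (unliftP ord0 j') => [j'' ->|->]; rewrite ?(inj_eq lift_inj)//.
    + by rewrite dotC nuT.
    + by rewrite nuT.
  - by case: (unliftP ord0 i') => [i'' _|_]; [rewrite dotC YT|rewrite nuY].
  - by case: (unliftP ord0 j') => [j'' _|_]; [rewrite YT|rewrite dotC nuY].
rewrite {1}(orthonormal_expansion x r_orth) !big_ord_recl addrA.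
rewrite /r unlift_none liftK unlift_none; congr (_ + _).
by apply: eq_bigr => i _; rewrite !liftK.
Qed.

(** The tangential components of p vanish, and <p, Y> = cos(rho), <p, nu> = -u. So |p| = 1 reads
    cos(rho)^2 + u^2 = 1, and u > 0 fixes the sign. It serves both at minima of u and at minima of
    rho. *)
Lemma critical_pole z (e : 'I_n -> 'rV[R]_n.+2) : S z ->
  (forall i, dir_tangent p z (e i)) ->
  (forall i j, dot (dY z (e i)) (dY z (e j)) = (i == j)%:R) ->
  (forall i, dot p (dY z (e i)) = 0) ->
  u z = sin (rho z) /\ p = cos (rho z) *: Y z - sin (rho z) *: nu z.
Proof.
move=> Sz Te orth crit; have [nu1 nuY _ _] := nu_normal Sz.
have pE := frame_expansion p Sz Te orth.
rewrite big1 ?addr0 in pE; last by move=> i _; rewrite crit scale0r.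
rewrite (dot_pole_graph rho hp Sz) (dot_pole_normal nu_normal Sz) in pE.
have u0 := support_function_gt0 hp rhoC1 rho_range nu_normal Sz.
have s0 := sin_rho_gt0 rho_range Sz.
have := hp; rewrite {2}pE dotDr !dotZr (dot_pole_graph rho hp Sz).
rewrite (dot_pole_normal nu_normal Sz) mulrNN => h.
have us : u z = sin (rho z).
  apply/eqP; rewrite -(@eqrXn2 _ 2)// ?ltW//; apply/eqP.
  by have := cos2Dsin2 (rho z); rewrite !expr2 -h => /addrI.
by split=> //; rewrite -us -scaleNr.
Qed.

(** The Weingarten equation alone does not assert that [nu] is differentiable. Since l_i dY(e_i) is
    nonzero, the derivative is not the default value 0, so the limit exists. *)
Lemma is_derive_normal_ray z (e : 'rV[R]_n.+2) (li : R) :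
  li != 0 -> dY z e != 0 -> sdiff p nu z e = li *: dY z e ->
  is_derive (0 : R) 1 (nu \o ray p z e) (li *: dY z e).
Proof.
move=> l0 dY0 h; apply/(is_derive_line (nu \o dir_proj p)).
apply: DeriveDef => //; apply: derive_nonzero_derivable.
by rewrite [X in X != _]h scaler_eq0 negb_or l0.
Qed.

Lemma support_function_min z l : S z ->
  principal_curvatures p rho nu z l -> (forall i, 0 < l i) ->
  (forall x, S x -> u z <= u x) -> u z = sin (rho z).
Proof.
move=> Sz [e [Te orth W]] l0 umin.
have [] // := critical_pole Sz Te orth => i.
have dY0 := orthonormal_neq0 i orth.
have dnu := is_derive_normal_ray (lt0r_neq0 (l0 i)) dY0 (W i).
have Sr s := ray_sphere s Sz (Te i).
have du : is_derive (0 : R) 1 (u \o ray p z (e i)) (- (l i * dot p (dY z (e i)))).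
  have -> : u \o ray p z (e i) =
            fun s => dot (cst (- p) s) ((nu \o ray p z (e i)) s).
    apply/funext => s.
    by rewrite /= /cst dotNl (dot_pole_normal nu_normal (Sr s)) opprK.
  apply: (is_derive_eq (is_derive_dot (is_derive_cst (- p) (0 : R) 1) dnu)).
  by rewrite dot0l add0r dotZr dotNl mulrN.
have u0_min s : (u \o ray p z (e i)) 0 <= (u \o ray p z (e i)) s.
  by rewrite /= (ray0 _ Sz); exact: umin.
have /eqP := is_derive_min du u0_min.
by rewrite oppr_eq0 mulf_eq0 (gt_eqF (l0 i)) /= => /eqP.
Qed.

(** In [curvature_le_min] a difference quotient of order one is paired with this velocity; its
    continuity at 0 takes the place of a second derivative of Y. *)
Lemma graph_velocity_cvg z v j : S z -> dir_tangent p z v ->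
  dY (ray p z v s) (ray_velocity z v s) ord0 j @[s --> (0 : R)] -->
  dY z v ord0 j.
Proof.
move=> Sz Tv.
have [U [g [oU Uz [dg Dg] fg]]] := rhoC1 Sz.
pose G := gradient g.
have Sr s := ray_sphere s Sz Tv.
have Tw s := curve_velocity_tangent Sr (is_derive_ray s Sz Tv).
have r0 := ray0 v Sz; have w0 := ray_velocity0 z v.
have rc := derivable_cvg (is_derive_ray 0 Sz Tv).
have wc : ray_velocity z v s @[s --> (0 : R)] --> ray_velocity z v 0.
  exact: ray_velocity_cvg.
move: (ray p z v) (ray_velocity z v) Sr Tw r0 w0 rc wc.
move=> r w Sr Tw r0 w0; rewrite r0 w0 => rc wc.
pose D s := dot (G (r s)) (w s).
pose V s := D s * (- sin (g (r s)) * p ord0 j + cos (g (r s)) * r s ord0 j)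
            + sin (g (r s)) * w s ord0 j.
have VE s : U (r s) -> dY (r s) (w s) ord0 j = V s.
  move=> Us; rewrite (sdiff_graph rhoC1 (Sr s) (Tw s)) !mxE (fg _ (Sr s) Us).
  rewrite (sdiff_extension oU Us (dg _ Us) fg (Sr s) (Tw s)).
  by rewrite (derive_gradient _ (dg _ Us)).
have gc : g (r s) @[s --> (0 : R)] --> g z.
  exact: (cvg_comp _ _ rc (differentiable_continuous (dg _ Uz))).
have sc : sin (g (r s)) @[s --> (0 : R)] --> sin (g z).
  exact: (cvg_comp _ (@sin R) gc (@continuous_sin R (g z))).
have cc : cos (g (r s)) @[s --> (0 : R)] --> cos (g z).
  exact: (cvg_comp _ (@cos R) gc (@continuous_cos R (g z))).
have Dc : D s @[s --> (0 : R)] --> dot (G z) v.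
  apply: cvg_dot => i; last exact: cvg_entry wc.
  have Gz := @gradient_continuous R n g U z i (conj dg Dg) Uz.
  exact: (cvg_comp r (fun y => gradient g y ord0 i) rc Gz).
have rj : r s ord0 j @[s --> (0 : R)] --> z ord0 j by exact: cvg_entry rc.
have wj : w s ord0 j @[s --> (0 : R)] --> v ord0 j by exact: cvg_entry wc.
have pj : cst (p ord0 j) s @[s --> (0 : R)] --> p ord0 j by exact: cvg_cst.
have e := VE 0; rewrite /V /D r0 w0 in e.
have Vc : V s @[s --> (0 : R)] --> dY z v ord0 j.
  rewrite (e Uz).
  exact: (cvgD (cvgM Dc (cvgD (cvgM (cvgN sc) pj) (cvgM cc rj))) (cvgM sc wj)).
apply: (cvg_trans _ Vc); apply: near_eq_cvg.
have : \forall s \near (0 : R), U (r s) by apply: rc; exact: open_nbhs_nbhs.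
by apply: filterS => s /VE ->.
Qed.

(* At a minimum of rho, p = cos(rho) Y - sin(rho) nu, so the height <p, Y>
   along a curve from z has derivative
   <p - cos(rho) Y(s) + sin(rho) nu(s), Y'(s)>, which is
   s (l sin(rho) - cos(rho)) + o(s) in a principal direction. *)
Lemma curvature_le_min z l i : S z ->
  principal_curvatures p rho nu z l -> (forall i, 0 < l i) ->
  (forall x, S x -> rho z <= rho x) ->
  u z = sin (rho z) /\ l i * sin (rho z) <= cos (rho z).
Proof.
move=> Sz [e [Te orth W]] l0 rmin.
have crit j : dot p (dY z (e j)) = 0.
  have dr := is_derive_rho_ray rhoC1 0 Sz (Te j).
  rewrite (ray0 _ Sz) ray_velocity0 in dr.
  have r0_min s : (rho \o ray p z (e j)) 0 <= (rho \o ray p z (e j)) s.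
    by rewrite /= (ray0 _ Sz); apply: rmin; exact: ray_sphere.
  by rewrite (dot_pole_sdiff hp rhoC1 Sz (Te j)) (is_derive_min dr r0_min) mulr0 oppr0.
have [uE pE] := critical_pole Sz Te orth crit.
split=> //; rewrite leNgt; apply/negP => lt_l.
have Sr s := ray_sphere s Sz (Te i).
pose gam := Y \o ray p z (e i).
pose vel s := dY (ray p z (e i) s) (ray_velocity z (e i) s).
pose nor := nu \o ray p z (e i).
have gam0 : gam 0 = Y z by rewrite /gam /= (ray0 _ Sz).
have nor0 : nor 0 = nu z by rewrite /nor /= (ray0 _ Sz).
have vel0 : vel 0 = dY z (e i) by rewrite /vel (ray0 _ Sz) ray_velocity0.
have dgam s : is_derive s 1 gam (vel s) by exact: is_derive_graph_ray.
have dnor : is_derive (0 : R) 1 nor (l i *: dY z (e i)).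
  apply: is_derive_normal_ray (W i); first exact: lt0r_neq0.
  exact: orthonormal_neq0 i orth.
(* By [pE], B(s) = p - cos(rho) Y(s) + sin(rho) nu(s). The terms added to p are orthogonal to Y'(s),
   so <B, Y'> = <p, Y'>; and B(0) = 0 makes the first derivative of B carry the second-order
   information. *)
pose B s := cos (rho z) *: (Y z - gam s) + sin (rho z) *: (nor s - nu z).
have B0 : B 0 = 0 by rewrite /B gam0 nor0 !subrr !scaler0 addr0.
have dB : is_derive (0 : R) 1 B ((l i * sin (rho z) - cos (rho z)) *: dY z (e i)).
  have -> : B = cos (rho z) *: (cst (Y z) - gam) + sin (rho z) *: (nor - cst (nu z)).
    by [].
  have dg := dgam 0; rewrite vel0 in dg.
  have hY := is_derive_cst (Y z) (0 : R) 1.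
  have hn := is_derive_cst (nu z) (0 : R) 1.
  apply: (is_derive_eq (is_deriveD (is_deriveZ (cos (rho z)) (is_deriveB hY dg))
    (is_deriveZ (sin (rho z)) (is_deriveB dnor hn)))).
  rewrite sub0r subr0 scalerN scalerA -scaleNr -scalerDl.
  by congr (_ *: _); ring.
have Tvel s : dir_tangent p (ray p z (e i) s) (ray_velocity z (e i) s).
  exact: (curve_velocity_tangent Sr (is_derive_ray s Sz (Te i))).
pose psi s := dot p (gam s).
have dpsi s : is_derive s 1 psi (dot (B s) (vel s)).
  apply: (is_derive_eq (is_derive_dot (is_derive_cst p s 1) (dgam s))).
  rewrite dot0l add0r /cst {1}pE /B !scalerDr !scalerN.
  have gv : dot (gam s) (vel s) = 0.
    exact: (dot_graph_sdiff hp rhoC1 (Sr s) (Tvel s)).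
  have nv : dot (nor s) (vel s) = 0.
    by have [_ _ nuT _] := nu_normal (Sr s); exact: (nuT _ (Tvel s)).
  by rewrite !dotDl !dotNl !dotZl gv nv; ring.
have quot : dot (s^-1 *: B s) (vel s) @[s --> (0 : R)^'] -->
    l i * sin (rho z) - cos (rho z).
  have Bc : s^-1 *: B s @[s --> (0 : R)^'] -->
      (l i * sin (rho z) - cos (rho z)) *: dY z (e i).
    case: dB => dB <-; move: dB; rewrite /derivable /derive.
    have -> : (fun h : R => h^-1 *: ((B \o shift 0) (h *: 1) - B 0)) =
              (fun h => h^-1 *: B h).
      by apply/funext => h; rewrite /= addr0 B0 subr0 [_%:A]mulr1.
    by [].
  have -> : l i * sin (rho z) - cos (rho z) =
      dot ((l i * sin (rho z) - cos (rho z)) *: dY z (e i)) (dY z (e i)).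
    by rewrite dotZl orth eqxx mulr1.
  apply: cvg_dot => j; first exact: cvg_entry Bc.
  have velc : vel s ord0 j @[s --> (0 : R)] --> dY z (e i) ord0 j.
    exact: graph_velocity_cvg.
  exact: cvg_within_filter velc.
have quot_gt0 : \forall s \near (0 : R)^', 0 < dot (s^-1 *: B s) (vel s).
  by apply: cvgr_gt quot _ _; lra.
have [d /= d0 ball_d] := quot_gt0.
have [b b0 bd] : exists2 b, 0 < b & b < d by exists (d / 2); lra.
(* A positive derivative on (0, b) would raise the height <p, Y> = cos(rho), that is, bring rho
   below its minimum. *)
have [c] := @MVT R psi (fun s => dot (B s) (vel s)) 0 b b0 (fun s _ => dpsi s)
  (continuous_subspaceT (fun s => derivable_cvg (dpsi s))).
rewrite in_itv/= => /andP[c0 cb] psiE.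
have : 0 < psi b - psi 0.
  rewrite psiE subr0; apply: (mulr_gt0 _ b0).
  have cd : `|0 - c| < d by rewrite sub0r normrN (gtr0_norm c0) (lt_trans cb).
  have := ball_d c cd (lt0r_neq0 c0).
  by rewrite dotZl pmulr_rgt0 ?invr_gt0.
have -> : psi b = cos (rho (ray p z (e i) b)) by exact: (dot_pole_graph rho hp (Sr b)).
have -> : psi 0 = cos (rho z) by rewrite /psi gam0; exact: (dot_pole_graph rho hp Sz).
rewrite subr_gt0 ltNge; case/negP.
by rewrite (ler_cos_pihalf (rho_range (Sr b)) (rho_range Sz)); exact: (rmin _ (Sr b)).
Qed.

End CriticalPoints.

(** * Quotients of elementary symmetric functions *)

Section ElementarySymmetric.
Context {R : realType} {n : nat}.
Implicit Types (l : 'I_n -> R).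

Lemma sigma_gt0 m l : (m <= n)%N -> (forall i, 0 < l i) -> 0 < sigma m l.
Proof.
move=> mn l0; rewrite /sigma.
have [A Am] : exists A : {set 'I_n}, #|A| == m.
  exists [set widen_ord mn i | i in 'I_m]%SET.
  by rewrite card_imset ?card_ord// => i j /(congr1 val)/= ij; exact: val_inj.
rewrite (bigD1 A)//=; apply: ltr_wpDr; first last.
  by apply: prodr_gt0.
by apply: sumr_ge0 => B _; apply: prodr_ge0 => i _; exact: ltW.
Qed.

(* Count pairs (A, i) with i in A, #|A| = m + 1, in two ways. *)
Lemma sigma_succ m l :
  m.+1%:R * sigma m.+1 l =
  \sum_(B : {set 'I_n} | #|B| == m) \sum_(i | i \notin B) l i * \prod_(j in B) l j.
Proof.
rewrite /sigma mulr_sumr.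
transitivity (\sum_(A : {set 'I_n} | #|A| == m.+1) \sum_(i in A) \prod_(j in A) l j).
  apply: eq_bigr => A /eqP Am.
  by rewrite sumr_const Am mulr_natl.
rewrite !pair_big_dep /=.
rewrite (reindex_onto (fun x : {set 'I_n} * 'I_n => (x.2 |: x.1, x.2))
                      (fun y => (y.1 :\ y.2, y.2))) /=; last first.
  by move=> [A i] /= /andP[_ iA]; rewrite finset.setD1K.
apply: eq_big => [[B i]|[B i]] /=.
  rewrite finset.setU11 andbT xpair_eqE eqxx andbT.
  have [iB|iB] := boolP (i \in B); last first.
    by rewrite finset.setU1K// eqxx cardsU1 iB add1n eqSS !andbT.
  rewrite andbF; apply/negbTE; rewrite negb_and; apply/orP; right.
  by apply: contraTneq iB => <-; rewrite !inE eqxx.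
rewrite finset.setU11 andbT xpair_eqE eqxx andbT => /andP[_ /eqP BE].
by rewrite big_setU1// -BE !inE eqxx.
Qed.

(** In the double count each set B of size m leaves n - m indices outside, each contributing at most
    a; dividing by m + 1 produces the constant [cnk]. *)
Lemma sigma_succ_le m l (a : R) : (m <= n)%N ->
  (forall i, 0 < l i) -> (forall i, l i <= a) ->
  sigma m.+1 l <= a * cnk (n := n) m * sigma m l.
Proof.
move=> mn l0 la; rewrite -(@ler_pM2l _ m.+1%:R) ?ltr0Sn// sigma_succ.
have -> : m.+1%:R * (a * cnk (n := n) m * sigma m l) =
          (a * (n - m)%:R) * sigma m l.
  by rewrite /cnk natrB//; field; rewrite nat1r pnatr_eq0.
rewrite mulr_sumr; apply: ler_sum => B /eqP Bm.
rewrite -mulr_suml ler_wpM2r ?prodr_ge0// => [i _|]; first exact: ltW.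
apply: (@le_trans _ _ (\sum_(i | i \notin B) a)); first exact: ler_sum.
have -> : \sum_(i | i \notin B) a = \sum_(i in ~: B) a.
  by apply: eq_bigl => i; rewrite inE.
by rewrite sumr_const cardsCs finset.setCK Bm card_ord mulr_natr.
Qed.

End ElementarySymmetric.

(** [sigma_succ_le] with a = cot(r), multiplied by sin(r). The factor sin(r) stands for u, which
    equals sin(rho) at a minimum of rho. *)
Lemma speed_ge0 {R : realType} {n : nat} k (l : 'I_n -> R) (r : R) :
  (k <= n)%N -> 0 < sin r -> (forall i, 0 < l i) ->
  (forall i, l i * sin r <= cos r) ->
  0 <= cnk (n := n) k * cos r - sin r * (sigma k.+1 l / sigma k l).
Proof.
move=> kn s0 l0 lr; have sk0 := sigma_gt0 kn l0.
have la i : l i <= cos r / sin r by rewrite ler_pdivlMr.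
rewrite subr_ge0 mulrA ler_pdivrMr// -ler_pdivlMl// mulrA mulrA.
have := sigma_succ_le kn l0 la; congr (_ <= _ * _).
by field; rewrite gt_eqF.
Qed.

(** * From smoothness in space-time to C1 time slices *)

Section Smoothness.
Context {R : realType}.

Lemma smooth_on_C1 {V W : normedModType R} (A : set V) (f : V -> W) :
  smooth_on A f -> C1_on A f.
Proof.
by move=> sf a /sf [U [g [oU Ua Cg fg]]]; exists U, g; split => //; exact: Cg.
Qed.

Lemma C1_on_continuous {V W : normedModType R} (A : set V) (f : V -> W) :
  C1_on A f -> {within A, continuous f}.
Proof.
move=> Cf; apply/subspace_continuousP => a Aa.
have [U [g [oU Ua [dg _] fg]]] := Cf a Aa.
have gc : g x @[x --> a] --> g a by exact: differentiable_continuous (dg _ Ua).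
have gw : g x @[x --> within A (nbhs a)] --> f a.
  by rewrite (fg _ Aa Ua); exact: cvg_within_filter gc.
apply: (cvg_trans _ gw); apply: near_eq_cvg; rewrite near_withinE.
have : \forall x \near a, U x by exact: open_nbhs_nbhs.
by apply: filterS => x Ux Ax; symmetry; exact: fg.
Qed.

Lemma C1_on_slice {V W : normedModType R} (A : set V) (B : set R^o)
    (f : V * R^o -> W) (t : R^o) :
  B t -> C1_on [set y : V * R^o | A y.1 /\ B y.2] f -> C1_on A (fun x => f (x, t)).
Proof.
move=> Bt Cf a Aa; have [U [g [oU Ua [dg Dg] fg]]] := Cf (a, t) (conj Aa Bt).
pose i (x : V) : V * R^o := (x, t).
have di x : differentiable i x.
  by apply: differentiable_pair; [exact: ex_diff|exact: differentiable_cst].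
have ci x : {for x, continuous i} by exact: differentiable_continuous.
exists (i @^-1` U), (g \o i); split => //.
- by apply: open_comp => // x _; exact: ci.
- split=> [x Ux|v x Ux]; first by apply: differentiable_comp => //; exact: dg.
  have -> : 'D_v (g \o i) = 'D_((v, 0) : V * R^o) g \o i.
    apply/funext => y; rewrite /derive /=.
    set q1 := fun h => _; set q2 := fun h => _; suff -> : q1 = q2 by [].
    apply/funext => h; rewrite /q1 /q2 /= /i; congr (_ *: (g _ - _)).
    by congr pair; rewrite /= scaler0 add0r.
  exact: (cvg_comp i _ (ci x) (Dg _ _ Ux)).
- by move=> x Ax Ux; apply: fg.
Qed.

End Smoothness.

(** * Compactness of the sphere of directions *)

Section DirSphereCompact.
Context {R : realType} {n : nat}.
Implicit Types p : 'rV[R]_n.+2.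

Lemma dir_sphere_nonempty p : exists z, dir_sphere p z.
Proof.
(* The linear form <., p> on a space of dimension n + 2 has a nontrivial kernel; a nonzero element
   of it is then normalised. *)
pose v := nz_row (kermx p^T).
have v0 : v != 0.
  rewrite nz_row_eq0 -mxrank_eq0 mxrank_ker subn_eq0 -ltnNge.
  by rewrite (leq_ltn_trans (rank_leq_col _)).
have vp : dot v p = 0.
  have /sub_kermxP/matrixP/(_ ord0 ord0) := nz_row_sub (kermx p^T).
  by rewrite !mxE => <-; apply: eq_bigr => i _; rewrite mxE.
have vv : 0 < dot v v by rewrite lt_neqAle dot_ge0 andbT eq_sym dot_eq0.
exists ((Num.sqrt (dot v v))^-1 *: v); split; rewrite !dotZl ?dotZr ?vp ?mulr0//.
by rewrite mulrA -expr2 exprVn sqr_sqrtr ?mulVf ?gt_eqF// ltW.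
Qed.

Lemma dir_sphere_compact p : compact (dir_sphere p).
Proof.
apply: bounded_closed_compact.
- exists 1; split=> // M M1 z [z1 _]; rewrite /Num.Def.normr/= mx_normrE.
  apply: bigmax_le => [|[i j] _ /=]; first by rewrite (le_trans _ (ltW M1)).
  apply: (le_trans _ (ltW M1)); rewrite ord1 -(@expr_le1 _ 2)// real_normK ?num_real//.
  rewrite -z1 /dot (bigD1 j)//= -expr2 lerDl.
  by apply: sumr_ge0 => k _; exact: sqr_ge0.
- have dc (f : 'rV[R]_n.+2 -> 'rV[R]_n.+2) : continuous f ->
      continuous (fun z => dot z (f z)).
    move=> fc z; have fz : f x @[x --> z] --> f z by exact: fc.
    have idz : x @[x --> z] --> z by [].
    suff : dot x (f x) @[x --> z] --> dot z (f z) by [].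
    by apply: (cvg_dot (F := nbhs z)) => i; [exact: cvg_entry idz|exact: cvg_entry fz].
  have -> : dir_sphere p = (fun z => dot z z) @^-1` [set 1] `&`
                           (fun z => dot z p) @^-1` [set 0] by [].
  apply: closedI; (apply: closed_comp; last exact: closed_eq) => z _.
    by apply: (dc id) => x; exact: cvg_id.
  by apply: (dc (cst p)); exact: cst_continuous.
Qed.

Lemma dir_sphere_min p (f : 'rV[R]_n.+2 -> R) :
  {within dir_sphere p, continuous f} ->
  exists2 z, dir_sphere p z & forall x, dir_sphere p x -> f z <= f x.
Proof.
move=> fc; have [z0 Sz0] := dir_sphere_nonempty p.
have [|z /set_mem Sz zmin] := compact_EVT_min _ (@dir_sphere_compact p) fc.
  by exists z0.
by exists z => // x Sx; apply: zmin; rewrite inE.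
Qed.

End DirSphereCompact.

(** * Bounds for a single strictly convex graph *)

Section StrictlyConvexGraph.
Context {R : realType} {n : nat}.
Variables (p : 'rV[R]_n.+2) (rho : 'rV[R]_n.+2 -> R).
Variables (nu : 'rV[R]_n.+2 -> 'rV[R]_n.+2) (lam : 'rV[R]_n.+2 -> 'I_n -> R).
Local Notation S := (dir_sphere p).
Local Notation u := (support_function p rho nu).

Hypotheses (hp : dot p p = 1) (rhoC1 : C1_on S rho) (rho_range : radius_range p rho)
  (convex : strictly_convex_with p rho nu lam).

Lemma support_function_argmin :
  exists z0, [/\ S z0, forall z, S z -> u z0 <= u z & u z0 = sin (rho z0)].
Proof.
have [nu_normal curv] := convex.
have [z0 Sz0 z0_min] := dir_sphere_min
  (support_function_continuous hp rhoC1 rho_range nu_normal).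
exists z0; split => //; have [pc l0] := curv z0 Sz0.
exact: (support_function_min hp rhoC1 rho_range nu_normal Sz0 pc l0 z0_min).
Qed.

Lemma sin_rho_le z r : S z -> 0 < r -> r <= rho z -> sin r <= sin (rho z).
Proof.
move=> Sz r0; rewrite le_eqVlt => /orP[/eqP->//|rz].
have /andP[_ zpi] := rho_range Sz.
by rewrite ltW// ltr_sin// in_itv/=; lra.
Qed.

Lemma support_function_ge (r : R) : 0 < r -> (forall z, S z -> r <= rho z) ->
  forall z, S z -> sin r <= u z.
Proof.
move=> r0 rle z Sz; have [z0 [Sz0 z0_min u0]] := support_function_argmin.
apply: le_trans (z0_min z Sz); rewrite u0; apply: sin_rho_le => //; exact: rle.
Qed.

(** The two suprema are bounded separately: pi/2 bounds rho, and |drho| u <= 1 with u >= sin(r)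
    bounds the differential by 1 / sin(r). *)
Lemma C1norm_le (r : R) : 0 < r -> (forall z, S z -> r <= rho z) ->
  (C1norm p rho <= (pi / 2 + (sin r)^-1)%:E)%E.
Proof.
move=> r0 rle; have [nu_normal _] := convex.
have sr0 : 0 < sin r.
  have [z0 Sz0] := dir_sphere_nonempty p.
  have /andP[_ zpi] := rho_range Sz0; have := rle _ Sz0; have := pi_gt0 R => *.
  by apply: sin_gt0_pi; lra.
rewrite EFinD; apply: leeD; apply: ge_ereal_sup => _ [a + <-].
- move=> [z Sz <-]; have /andP[z0 zpi] := rho_range Sz.
  by rewrite lee_fin gtr0_norm// ltW.
- move=> [z [v [Sz Tv v1 ->]]]; rewrite lee_fin.
  have := drho_le hp rhoC1 rho_range nu_normal Sz Tv v1.
  have uge := support_function_ge r0 rle Sz.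
  rewrite -ler_pdivlMr ?(lt_le_trans sr0)// div1r => h.
  by apply: (le_trans h); rewrite lef_pV2 ?posrE ?(lt_le_trans sr0).
Qed.

End StrictlyConvexGraph.

(** * The maximum principle along the flow *)

Section Flow.
Context {R : realType} {n : nat}.
Variables (k : nat) (p : 'rV[R]_n.+2) (rho0 : 'rV[R]_n.+2 -> R) (T : \bar R).
Variables (X : 'rV[R]_n.+2 -> R -> 'rV[R]_n.+2) (rho : 'rV[R]_n.+2 -> R -> R)
  (nu : 'rV[R]_n.+2 -> R -> 'rV[R]_n.+2) (lam : 'rV[R]_n.+2 -> R -> 'I_n -> R).
Local Notation S := (dir_sphere p).

Hypotheses (hn : (0 < n)%N) (kn : (k <= n)%N) (hp : dot p p = 1) (T0 : (0 < T)%E)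
  (flow : flow_solution k p rho0 T X rho nu lam).

Lemma flow_C1 t : times T t -> C1_on S (rho^~ t).
Proof.
move=> Tt; have [[_ /smooth_on_C1 rs] _ _ _] := flow.
exact: (C1_on_slice Tt rs).
Qed.

Lemma times0 : times T 0.
Proof. by split. Qed.

Lemma flow_at t : times T t ->
  [/\ X^~ t @` S = radial_graph p (rho^~ t), radius_range p (rho^~ t) &
      strictly_convex_with p (rho^~ t) (nu^~ t) (lam^~ t)].
Proof. by have [_ _ + _] := flow => /[apply] -[]. Qed.

(** The initial condition only equates images, so radii are compared through <p, .> = cos(rho),
    which is injective on (0, pi/2). Equality of the values of rho at z and at some z' is enough to
    transfer lower bounds. *)
Lemma flow_initial z : S z -> radius_range p rho0 ->
  exists2 z', S z' & rho z 0 = rho0 z'.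
Proof.
move=> Sz range0; have [_ init _ _] := flow.
have [img range _] := flow_at times0.
have : radial_graph p rho0 (graph_param p (rho^~ 0) z).
  by rewrite -init img; exists z.
move=> [z' Sz' e]; exists z' => //.
have : dot p (graph_param p rho0 z') = dot p (graph_param p (rho^~ 0) z).
  by rewrite e.
rewrite !(dot_pole_graph _ hp)// => h.
have r1 := range _ Sz; have r2 := range0 _ Sz'; rewrite /= in r1.
by apply: le_anti; rewrite -(ler_cos_pihalf r1 r2) -(ler_cos_pihalf r2 r1) h lexx.
Qed.

Lemma flow_speed_ge0 z t : S z -> times T t ->
  (forall x, S x -> rho z t <= rho x t) ->
  support_function p (rho^~ t) (nu^~ t) z = sin (rho z t) /\
  0 <= cnk (n := n) k * cos (rho z t)
       - sin (rho z t) * (sigma k.+1 (lam z t) / sigma k (lam z t)).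
Proof.
move=> Sz Tt zmin; have [_ range [normal curv]] := flow_at Tt.
have [pc l0] := curv z Sz.
have cl i := curvature_le_min hp (flow_C1 Tt) range normal i Sz pc l0 zmin.
split; first by have [] := cl (Ordinal hn).
apply: speed_ge0 => // [|i]; first exact: (sin_rho_gt0 range Sz).
by have [] := cl i.
Qed.

(* Maximum principle: at a minimum (z, t) with t > 0 of rho + eps t, the
   points X(zeta, s), s < t, satisfy
   <p, X(zeta, s)> <= cos(rho(z, t) + eps (t - s)), so that the speed at
   (z, t) is at most - eps. *)
Lemma flow_radius_ge r : (forall z, S z -> r <= rho z 0) ->
  forall z t, S z -> times T t -> r <= rho z t.
Proof.
move=> r_le z1 t1 Sz1 Tt1; rewrite leNgt; apply/negP => lt_r.
have [t1_ge0 t1T] := Tt1.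
have t1_gt0 : 0 < t1.
  by rewrite lt_neqAle t1_ge0 andbT; apply/eqP => t1E; have := r_le _ Sz1;
    rewrite t1E leNgt lt_r.
(* This eps raises rho at (z1, t1) by half of its deficit. Thus rho + eps t is still below r there
   but at least r at time 0, and its minimum over K occurs at a positive time. *)
have [eps eps0 eps_r] : exists2 eps, 0 < eps & rho z1 t1 + eps * t1 < r.
  exists ((r - rho z1 t1) / (2 * t1)); first by rewrite divr_gt0 ?mulr_gt0 ?subr_gt0.
  rewrite [_ / _ * _](_ : _ = (r - rho z1 t1) / 2); first by lra.
  by field; rewrite gt_eqF.
pose K := S `*` `[0, t1].
pose w (y : 'rV[R]_n.+2 * R^o) := rho y.1 y.2 + eps * y.2.
have wc : {within K, continuous w}.
  have [[_ /smooth_on_C1/C1_on_continuous rc] _ _ _] := flow.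
  have rcK : {within K, continuous (fun y : 'rV[R]_n.+2 * R^o => rho y.1 y.2)}.
    apply: continuous_subspaceW rc => -[z t] [/= Sz]; rewrite in_itv/= => /andP[t0 tt1].
    by split => //; split => //; apply: le_lt_trans t1T; rewrite lee_fin.
  have ec : continuous (fun y : 'rV[R]_n.+2 * R^o => eps * y.2 : R).
    by move=> y; apply: cvgM; [exact: cvg_cst|exact: cvg_snd].
  by move=> y; apply: cvgD; [exact: rcK|exact: (continuous_subspaceT ec)].
have Kc : compact K by apply: compact_setX; [exact: dir_sphere_compact|exact: segment_compact].
have [|[zs ts] /set_mem[/= Szs]] := compact_EVT_min _ Kc wc.
  by exists (z1, t1); split => //=; rewrite in_itv/= t1_ge0 lexx.
rewrite in_itv/= => /andP[ts_ge0 ts_le] wmin.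
have {}wmin z t : S z -> 0 <= t -> t <= t1 -> rho zs ts + eps * ts <= rho z t + eps * t.
  by move=> Sz t0 tt1; apply: (wmin (z, t)); rewrite inE; split => //=; rewrite in_itv/= t0.
have ts_gt0 : 0 < ts.
  rewrite lt_neqAle ts_ge0 andbT; apply/eqP => ts0.
  have := wmin _ _ Sz1 t1_ge0 (lexx t1); have := r_le _ Szs.
  by rewrite -ts0; lra.
have T_le t : 0 <= t -> t <= t1 -> times T t.
  by move=> t0 tt1; split => //; apply: le_lt_trans t1T; rewrite lee_fin.
have Tts := T_le _ ts_ge0 ts_le.
have zs_min x : S x -> rho zs ts <= rho x ts.
  by move=> Sx; have := wmin _ _ Sx ts_ge0 ts_le; rewrite lerD2r.
have [uE speed] := flow_speed_ge0 Szs Tts zs_min.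
have [img range [normal _]] := flow_at Tts.
have : radial_graph p (rho^~ ts) (graph_param p (rho^~ ts) zs) by exists zs.
rewrite -img => -[zeta Szeta Xzeta].
have [_ _ _ eqn] := flow.
have := eqn _ _ _ Szeta Szs Tts Xzeta; rewrite uE.
set f := (X in X *: _) in speed * => dX; rewrite -/f in speed.
have sr0 := sin_rho_gt0 range Szs; rewrite /= in sr0.
have s_gt0 : \forall s \near ts, 0 < s.
  by apply: (@cvgr_gt _ _ (nbhs ts) _ id ts) => //; exact: cvg_id.
pose Q s := dot p ((s - ts)^-1 *: (X zeta s - X zeta ts)).
(* The limit is taken from the left, because ts may be the final time t1 of K. Its value is -(f
   sin(rho)), as <p, nu> = -u = -sin(rho) at the minimum. *)
have Qc : Q s @[s --> ts^'-] --> - (f * sin (rho zs ts)).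
  have -> : - (f * sin (rho zs ts)) = dot p (f *: nu zs ts).
    by rewrite dotZr (dot_pole_normal normal Szs) uE mulrN.
  have left_within : (ts^'- : set_system R) `=>` within (times T) ts^'.
    move=> A; rewrite /within /= !near_withinE => A_near.
    apply: filterS2 s_gt0 A_near => s s_gt0 A_near s_lt.
    by apply: A_near; [rewrite lt_eqF|apply: T_le (ltW s_gt0) (le_trans (ltW s_lt) ts_le)].
  have dX' := cvg_trans (cvg_fmap2 left_within) dX.
  by apply: cvg_dot => i; [exact: cvg_cst|exact: cvg_entry dX'].
have Q_ge : \forall s \near ts^'-, eps * sin (rho zs ts) <= Q s.
  rewrite near_withinE; apply: filterS s_gt0 => s s_gt0 s_lt.
  have Ts := T_le s (ltW s_gt0) (le_trans (ltW s_lt) ts_le).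
  have [imgs ranges _] := flow_at Ts.
  have : (X^~ s @` S) (X zeta s) by exists zeta.
  rewrite imgs => -[z' Sz' Xs].
  have rz := wmin _ _ Sz' Ts.1 (le_trans (ltW s_lt) ts_le).
  have /andP[_ z'pi] := ranges _ Sz'; have /andP[zs0 _] := range _ Szs.
  (* The particle lies at time s in some direction z' with rho(z', s) >= rho(zs, ts) + eps (ts - s).
     The tangent bound for cos and division by s - ts < 0 give Q >= eps sin(rho). *)
  have le_rho : rho zs ts <= rho z' s by nra.
  have := cos_le_tangent zs0 le_rho z'pi.
  rewrite /Q dotZr dotDr dotNr -Xs Xzeta !(dot_pole_graph _ hp)//= => hcos.
  rewrite ler_ndivlMl ?subr_lt0//.
  by nra.
have eps_f : eps * sin (rho zs ts) <= - (f * sin (rho zs ts)).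
  exact: cvgr_to_ge Qc Q_ge.
have := lt_le_trans (mulr_gt0 eps0 sr0) eps_f.
by rewrite oppr_gt0 ltNge (mulr_ge0 speed (ltW sr0)).
Qed.

End Flow.

Theorem theorem3p3 (R : realType) (n k : nat) (p : 'rV[R]_n.+2)
    (rho0 : 'rV[R]_n.+2 -> R)
    (hn : (1 <= n)%N) (hk : (k <= n - 1)%N)
    (hp : ambient_sphere p)
    (h0 : strictly_convex_graph p rho0) :
  (forall (T : \bar R) (X : 'rV[R]_n.+2 -> R -> 'rV[R]_n.+2)
      (rho : 'rV[R]_n.+2 -> R -> R)
      (nu : 'rV[R]_n.+2 -> R -> 'rV[R]_n.+2)
      (lam : 'rV[R]_n.+2 -> R -> 'I_n -> R),
    (0 < T)%E -> flow_solution k p rho0 T X rho nu lam ->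
    exists z0 : 'rV[R]_n.+2,
      [/\ dir_sphere p z0,
          forall z, dir_sphere p z ->
            support_function p (rho^~ 0) (nu^~ 0) z0 <= support_function p (rho^~ 0) (nu^~ 0) z &
          forall z t, dir_sphere p z -> times T t ->
            support_function p (rho^~ 0) (nu^~ 0) z0
              <= support_function p (rho^~ t) (nu^~ t) z])
  /\
  (exists C : R,
    forall (T : \bar R) (X : 'rV[R]_n.+2 -> R -> 'rV[R]_n.+2)
      (rho : 'rV[R]_n.+2 -> R -> R)
      (nu : 'rV[R]_n.+2 -> R -> 'rV[R]_n.+2)
      (lam : 'rV[R]_n.+2 -> R -> 'I_n -> R),
    (0 < T)%E -> flow_solution k p rho0 T X rho nu lam ->
    forall t, times T t -> (C1norm p (rho^~ t) <= C%:E)%E).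
Proof.
have kn : (k <= n)%N by apply: leq_trans hk _; rewrite leq_subr.
have {}hp : dot p p = 1 := hp.
split=> [T X rho nu lam T0 flow|].
- have [_ range conv] := flow_at flow (times0 T0).
  have rC1 := flow_C1 flow (times0 T0).
  have [z0 [Sz0 z0_min u0]] := support_function_argmin hp rC1 range conv.
  exists z0; split=> // z t Sz Tt.
  have [zm Szm zm_min] := dir_sphere_min (C1_on_continuous rC1).
  have /andP[rm0 _] := range _ Szm.
  have [_ ranget convt] := flow_at flow Tt.
  (* The chain is u(z0, 0) <= u(zm, 0) <= sin(rho(zm, 0)) <= u(z, t), with zm a minimum point of the
     initial radius. *)
  apply: (le_trans (z0_min _ Szm)).
  apply: (le_trans (support_function_le hp rC1 range conv.1 Szm)).
  apply: (support_function_ge hp (flow_C1 flow Tt) ranget convt) => // x Sx.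
  exact: (flow_radius_ge hn kn hp flow zm_min Sx Tt).
- have [/smooth_on_C1 rho0C1 range0 _] := h0.
  have [zm Szm zm_min] := dir_sphere_min (C1_on_continuous rho0C1).
  have /andP[rm0 _] := range0 _ Szm.
  (* The constant is built from the minimum of [rho0] before T and the solution are introduced,
     hence depends on the initial hypersurface only. *)
  exists (pi / 2 + (sin (rho0 zm))^-1) => T X rho nu lam T0 flow t Tt.
  have [_ ranget convt] := flow_at flow Tt.
  apply: (C1norm_le hp (flow_C1 flow Tt) ranget convt) => // x Sx.
  apply: (flow_radius_ge hn kn hp flow) => // z Sz.
  have [z' Sz' ->] := flow_initial hp T0 flow Sz range0.
  exact: zm_min.
Qed.
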